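(* Consider the cell problem $-\nabla\cdot(\nabla\chi\,A)=\nabla\cdot A$, $\chi$ $1$-periodic. The following hold: 1. If $A \in \mathsf{PD}_{\alpha,\beta}$, then the cell problem has a unique solution $\chi\in\dot{H}^1(\mathbb{T}^d;\mathbb{R}^d)$ and $$\|\chi\|_{\dot{H}^1(\mathbb{T}^d;\mathbb{R}^d)} \le \frac{\sqrt{d}\,\beta}{\alpha}.$$ 2. For $\chi^{(1)}$ and $\chi^{(2)}$ solutions to the cell problem associated with coefficients $A^{(1)},A^{(2)}\in\mathsf{PD}_{\alpha,\beta}$, respectively, it follows that $$\|\chi^{(2)}-\chi^{(1)}\|_{\dot{H}^1(\mathbb{T}^d;\mathbb{R}^d)} \le \frac{\sqrt{d}}{\alpha}\left(1+\frac{\beta}{\alpha}\right)\|A^{(1)}-A^{(2)}\|_{L^\infty(\mathbb{T}^d;\mathbb{R}^{d\times d})}.$$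
   Context: $\mathbb{T}^d$ is the $d$-dimensional unit torus ($1$-periodic functions). For $\beta \ge \alpha > 0$ fixed, $\mathsf{PD}_{\alpha,\beta}$ is the set of symmetric-matrix-valued $A \in L^\infty(\mathbb{T}^d;\mathbb{R}^{d\times d})$ with $\alpha|\xi|^2 \le \langle \xi, A(y)\xi\rangle \le \beta|\xi|^2$ for all $(y,\xi) \in \mathbb{T}^d\times\mathbb{R}^d$ (as usual for $L^\infty$ functions, in the almost everywhere sense in $y$). The norm is $\|A\|_{L^\infty}=\sup_{y}|A(y)|_F$ (essential supremum), $|\cdot|_F$ the Frobenius norm. $\dot{H}^1$ denotes the space of $1$-periodic, mean-zero $W^{1,2}(\mathbb{T}^d)$ functions (componentwise for vector-valued functions), with norm $\|g\|_{\dot{H}^1} = \|\nabla g\|_{L^2}$, where for matrix fields $\|B\|_{L^2}^2=\int_{\mathbb{T}^d}|B(y)|_F^2\,dy$. The cell problem is understood in the weak sense; it decouples: each component satisfies $-\nabla\cdot(A\nabla\chi_\ell) = \nabla\cdot(A e_\ell)$ weakly, i.e. $\int_{\mathbb{T}^d}\langle A\nabla\chi_\ell,\nabla v\rangle\,dy = -\int_{\mathbb{T}^d}\langle Ae_\ell,\nabla v\rangle\,dy$ for all $v\in\dot{H}^1(\mathbb{T}^d;\mathbb{R})$, $\ell=1,\dots,d$, with $e_\ell$ the standard basis vectors. *)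

(* Defs.v *)
From HB Require Import structures.
From mathcomp Require Import all_boot all_order all_algebra.
From mathcomp Require Import all_classical all_reals all_analysis.

Set Implicit Arguments.
Unset Strict Implicit.
Unset Printing Implicit Defensive.

Import Order.TTheory GRing.Theory Num.Theory.
Import numFieldNormedType.Exports.

Local Open Scope classical_set_scope.
Local Open Scope ring_scope.

(* R^d is 'rV[R]_d with the sigma-algebra generated by the coordinates, that
   is, its Borel sigma-algebra. *)
Definition measure_row_display : measure_display -> measure_display.
Proof. exact. Qed.

Section measurable_row.
Context d (T : measurableType d) (n : nat).

Let coors : 'I_n -> 'rV[T]_n -> T := fun i x => x ord0 i.

HB.instance Definition _ := @isMeasurable.Build (measure_row_display d)
  'rV[T]_n (g_sigma_preimage coors) (@sigma_algebra0 _ _ _)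
  (@sigma_algebraC _ _) (@sigma_algebra_bigcup _ _ _).

End measurable_row.

Lemma measurable_fun_rowP d1 d2 (T1 : measurableType d1)
    (T2 : measurableType d2) n (f : T1 -> 'rV[T2]_n) :
  measurable_fun [set: T1] f <->
  forall i, measurable_fun [set: T1] (fun x => f x ord0 i).
Proof.
apply: (@iff_trans _ (g_sigma_preimage
    (fun i => (fun v : 'rV[T2]_n => v ord0 i) \o f) `<=` measurable)).
  rewrite (@g_sigma_preimage_comp _ _ _ _
    (fun i (v : 'rV[T2]_n) => v ord0 i)); split=> [mf A [/= C preC <-]|prefS].
    exact: mf.
  by move=> _ A mA; apply: prefS; exists A.
split=> [mf i _ A mA|mf].
- apply: mf; apply: sub_sigma_algebra; rewrite -bigcup_seq/=.
  by exists i => /=; [rewrite mem_index_enum|exists A].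
- apply: smallest_sub; first exact: sigma_algebra_measurable.
  rewrite -bigcup_seq/=; apply: bigcup_sub => i _ A [B mB <-].
  exact: mf.
Qed.

(* Lebesgue measure on the unit cube [0,1]^d, by induction on d.  Integrals,
   norms and almost-everywhere statements on the torus T^d are those of
   1-periodic functions on R^d with respect to this measure. *)
Section torus_measure.
Local Open Scope ereal_scope.
Context (R : realType).

Definition unit_lebesgue :=
  mrestr (@lebesgue_measure R) (measurable_itv `[0%R, 1%R]).

HB.instance Definition _ := Measure.on unit_lebesgue.

Lemma unit_lebesgue_setT : unit_lebesgue setT = 1.
Proof.
rewrite /unit_lebesgue /mrestr setTI lebesgue_measure_itv/= lte_fin ltr01.
by rewrite oppr0 adde0.
Qed.

HB.instance Definition _ :=
  Measure_isProbability.Build _ _ _ unit_lebesgue unit_lebesgue_setT.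

Definition row_cons n (xy : measurableTypeR R * 'rV[R]_n) : 'rV[R]_n.+1 :=
  row_mx (const_mx xy.1 : 'rV_1) xy.2.

Lemma measurable_row_cons n :
  measurable_fun [set: measurableTypeR R * 'rV[R]_n] (@row_cons n).
Proof.
apply/measurable_fun_rowP => i; rewrite /row_cons.
have [j ->|j ->] := @split_ordP 1 n i.
  apply: (@eq_measurable_fun _ _ _ _ _
      (fun x : measurableTypeR R * 'rV[R]_n => x.1)).
    by move=> x _; exact/esym/(etrans (row_mxEl _ _ _ _))/mxE.
  exact: measurable_fst.
apply: (@eq_measurable_fun _ _ _ _ _
    (fun x : measurableTypeR R * 'rV[R]_n => x.2 ord0 j)).
  by move=> x _; exact/esym/row_mxEr.
by have /measurable_fun_rowP :=
  @measurable_snd _ _ (measurableTypeR R) 'rV[R]_n.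
Qed.

HB.instance Definition _ n :=
  isMeasurableFun.Build _ _ _ _ (@row_cons n) (@measurable_row_cons n).

Section cube_product.
Context (n : nat) (P : probability 'rV[R]_n R).

Definition cube_product : set (measurableTypeR R * 'rV[R]_n) -> \bar R :=
  unit_lebesgue \x P.

HB.instance Definition _ := Measure.on cube_product.

Lemma cube_product_setT : cube_product setT = 1.
Proof.
rewrite /cube_product -setXTT product_measure1E//.
by rewrite [X in X * _]probability_setT [X in _ * X]probability_setT mule1.
Qed.

HB.instance Definition _ :=
  Measure_isProbability.Build _ _ _ cube_product cube_product_setT.

End cube_product.

Fixpoint torus_measure (d : nat) : probability 'rV[R]_d R :=
  match d with
  | 0 => @dirac _ _ (0%R : 'rV[R]_0) R
  | n.+1 => distribution (cube_product (torus_measure n)) (@row_cons n)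
  end.

End torus_measure.
Arguments torus_measure {R} d.

Section torus.
Context (R : realType) (d : nat).
Local Notation pt := 'rV[R]_d.
Local Notation mu := (@torus_measure R d).

Definition basis_pt (i : 'I_d) : pt := delta_mx ord0 i.

Definition one_periodic (V : zmodType) (f : pt -> V) :=
  forall i, periodic f (basis_pt i).

Definition partial (i : 'I_d) (f : pt -> R) : pt -> R := 'D_(basis_pt i) f.

Fixpoint Ck (k : nat) (f : pt -> R) : Prop :=
  continuous f /\
  match k with
  | 0 => True
  | k'.+1 => forall i,
      (forall x, derivable f x (basis_pt i)) /\ Ck k' (partial i f)
  end.

Definition smooth (f : pt -> R) := forall k, Ck k f.

Definition inner (u v : 'cV[R]_d) : R := \sum_i u i ord0 * v i ord0.

Definition frobenius m n (B : 'M[R]_(m, n)) : R :=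
  Num.sqrt (\sum_i \sum_j B i j ^+ 2).

Definition L2norm m n (B : pt -> 'M[R]_(m, n)) : \bar R :=
  Lnorm mu 2%:E (fun y => (frobenius (B y))%:E).

Definition Linfnorm m n (B : pt -> 'M[R]_(m, n)) : \bar R :=
  Lnorm mu +oo%E (fun y => (frobenius (B y))%:E).

(* Vector fields are column vectors, so that matrices act on the left; the
   weak derivatives are tested against C^oo 1-periodic functions. *)
Definition is_weak_gradient (u : pt -> R) (G : pt -> 'cV[R]_d) : Prop :=
  [/\ one_periodic G,
      forall i, (fun y => G y i ord0) \in Lfun mu 2%:E &
      forall phi : pt -> R, smooth phi -> one_periodic phi -> forall i,
        (\int[mu]_y (u y * partial i phi y))%R =
        - (\int[mu]_y (G y i ord0 * phi y))%R].

(* Some weak gradient of u if there is one; it is unique up to a null set. *)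
Definition grad (u : pt -> R) : pt -> 'cV[R]_d :=
  xget (fun=> 0) [set G | is_weak_gradient u G].

Definition W12 (u : pt -> R) : Prop :=
  [/\ one_periodic u, u \in Lfun mu 2%:E & exists G, is_weak_gradient u G].

Definition H1dot (u : pt -> R) : Prop :=
  W12 u /\ (\int[mu]_y u y)%R = 0.

Definition component n (chi : pt -> 'cV[R]_n) (l : 'I_n) : pt -> R :=
  fun y => chi y l ord0.

Definition H1dot_vec n (chi : pt -> 'cV[R]_n) : Prop :=
  forall l, H1dot (component chi l).

Definition jacobian n (chi : pt -> 'cV[R]_n) : pt -> 'M[R]_(n, d) :=
  fun y => \matrix_(l, j) grad (component chi l) y j ord0.

Definition H1dot_norm n (chi : pt -> 'cV[R]_n) : \bar R :=
  L2norm (jacobian chi).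

Definition Linf_matrix (A : pt -> 'M[R]_d) : Prop :=
  [/\ one_periodic A, forall i j, measurable_fun setT (fun y => A y i j) &
      (Linfnorm A < +oo)%E].

Definition PD (alpha beta : R) (A : pt -> 'M[R]_d) : Prop :=
  Linf_matrix A /\
  \forall y \ae mu, (A y)^T = A y /\
    forall xi : 'cV[R]_d,
      alpha * inner xi xi <= inner xi (A y *m xi) <= beta * inner xi xi.

(* Weak form of - div (jacobian chi *m A) = div A, row by row: A being
   symmetric, row l of jacobian chi *m A is (A *m grad chi_l)^T and row l of A
   is (A *m e_l)^T. *)
Definition cell_solution (A : pt -> 'M[R]_d) (chi : pt -> 'cV[R]_d) : Prop :=
  H1dot_vec chi /\
  forall (l : 'I_d) (v : pt -> R), H1dot v ->
    (\int[mu]_y inner (A y *m grad (component chi l) y) (grad v y))%R =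
    - (\int[mu]_y inner (A y *m delta_mx l ord0) (grad v y))%R.

End torus.

(* Main.v *)
Require Import Defs.
From HB Require Import structures.
From mathcomp Require Import all_boot all_order all_algebra.
From mathcomp Require Import all_classical all_reals all_analysis.
From mathcomp Require Import measurable_realfun ess_sup_inf.
From mathcomp Require Import ring lra.

(** Functions are never identified modulo null sets, and [grad] is only a choice among weak
    gradients. Hence the forms are merely semidefinite, identities between gradients hold almost
    everywhere, and limits must be built pointwise, since periodicity is required at every point.
    One variational lemma, [psd_riesz], is used twice: on the span of the trigonometric functions,
    where together with totality it yields density in L^2, and on the mean-zero periodic W^{1,2}
    functions, where it solves the cell problem. It produces a sequence and not a vector, because
    the span is not complete; completeness is supplied separately in each use. With t = beta /
    alpha, the estimates bound each component of the gradient, squared, by t, and of the difference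
    by L^2 t / alpha^2, where L is the distance of the coefficients. Summing d components and taking
    roots gives sqrt(d t) and sqrt(d t) L / alpha; as t >= 1, sqrt t is at most t and at most 1 + t,
    which are the factors in the theorem. *)

(* The argument is Fourier-analytic.  Products of the functions
   cas t = cos t + sin t at integer frequencies are smooth and periodic,
   orthonormal, and total in L^1 of the torus: in dimension one, a function
   orthogonal to all of them is orthogonal to the bounded pointwise limits of
   trigonometric polynomials, hence to the indicators of intervals; Fubini then
   gives all dimensions.  Totality makes weak gradients unique almost
   everywhere, and Bessel's inequality for the components of the gradient gives
   the Poincare inequality.  With the completeness of L^2, the mean-zero
   periodic W^{1,2} functions are thus complete for the norm of the gradient, and
   each component of the corrector is the limit of a minimising sequence of the
   energy.

   For the estimates write e for the unit vector, w for a solution and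
   a(G, H) for the integral of <A G, H>.  Testing with w yields
   0 <= a(e + grad w, e + grad w) = a(e, e) - a(grad w, grad w), so that both
   |grad w|^2 and |e + grad w|^2 are at most beta / alpha in L^2.  If delta is the
   difference of two solutions, then a_2(grad delta, grad delta) is the integral
   of <(A_1 - A_2)(e + grad w_1), grad delta>. *)

Set Implicit Arguments.
Unset Strict Implicit.
Unset Printing Implicit Defensive.
Import Order.TTheory GRing.Theory Num.Theory.
Import numFieldNormedType.Exports.
Local Open Scope classical_set_scope.
Local Open Scope ring_scope.

(** * Symmetric positive semidefinite forms *)

Section psd_form.
Context (R : realType) (E : lmodType R) (V : set E) (b : E -> E -> R).

(** The laws are required only on a subset [V] of an ambient module, because integrals of products
    are bilinear only on square-integrable functions. Definiteness would fail for functions that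
    vanish almost everywhere. *)
Record psd_form := PsdForm {
  psdV0 : V 0;
  psdVP : forall a x y, V x -> V y -> V (a *: x + y);
  psdC : forall x y, V x -> V y -> b x y = b y x;
  psdP : forall a x y z, V x -> V y -> V z ->
    b (a *: x + y) z = a * b x z + b y z;
  psd_ge0 : forall x, V x -> 0 <= b x x }.

Hypothesis bP : psd_form.

Lemma psdVZ a x : V x -> V (a *: x).
Proof. by move=> Vx; rewrite -[_ *: _]addr0; apply: psdVP => //;
  exact: psdV0. Qed.

Lemma psdVD x y : V x -> V y -> V (x + y).
Proof. by move=> Vx Vy; rewrite -[x]scale1r; exact: psdVP. Qed.

Lemma psdVB x y : V x -> V y -> V (x - y).
Proof. by move=> Vx Vy; rewrite addrC -scaleN1r; exact: psdVP. Qed.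

Lemma psdDl x y z : V x -> V y -> V z -> b (x + y) z = b x z + b y z.
Proof. by move=> *; rewrite -{1}[x]scale1r psdP// mul1r. Qed.

Lemma psd0l z : V z -> b 0 z = 0.
Proof.
move=> Vz; have V0 := psdV0 bP.
have := psdDl V0 V0 Vz; rewrite addr0; lra.
Qed.

Lemma psdZl a x z : V x -> V z -> b (a *: x) z = a * b x z.
Proof.
move=> Vx Vz; have V0 := psdV0 bP.
by rewrite -[a *: x]addr0 psdP// psd0l// addr0.
Qed.

Lemma psdBl x y z : V x -> V y -> V z -> b (x - y) z = b x z - b y z.
Proof. by move=> *; rewrite addrC -scaleN1r psdP// mulN1r addrC. Qed.

Lemma psd_sqr a x y : V x -> V y ->
  b (a *: x + y) (a *: x + y) = a ^+ 2 * b x x + 2 * a * b x y + b y y.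
Proof.
move=> Vx Vy; have Vz := psdVP bP a Vx Vy.
rewrite psdP// [b x _]psdC// [b y (_ + _)]psdC// !psdP// (psdC bP Vy Vx); ring.
Qed.

Lemma discriminant_le0 (p q r : R) :
  0 <= p -> (forall t, 0 <= t ^+ 2 * p + 2 * t * q + r) -> q ^+ 2 <= p * r.
Proof.
rewrite le_eqVlt => /predU1P[<- H|p0 H].
  rewrite mul0r; have [->|q0] := eqVneq q 0; first by rewrite expr0n.
  (* For p = 0 the polynomial is affine; at this t it equals -1. *)
  have := H (- (r + 1) / (2 * q)).
  have -> : 2 * (- (r + 1) / (2 * q)) * q = - (r + 1) by field.
  by rewrite mulr0; lra.
(* The minimiser of the quadratic. *)
have := H (- q / p).
have -> : (- q / p) ^+ 2 * p + 2 * (- q / p) * q + r = (p * r - q ^+ 2) / p.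
  by field; rewrite gt_eqF.
by rewrite pmulr_lge0 ?invr_gt0// subr_ge0.
Qed.

Lemma psd_CauchySchwarz x y : V x -> V y -> b x y ^+ 2 <= b x x * b y y.
Proof.
move=> Vx Vy; apply: discriminant_le0 => [|t]; first exact: psd_ge0.
by rewrite -psd_sqr//; apply: psd_ge0 => //; exact: psdVP.
Qed.

Definition psd_cauchy (u : nat -> E) := forall e : R, 0 < e ->
  exists N, forall m n, (N <= m)%N -> (N <= n)%N -> b (u m - u n) (u m - u n)
    <= e.

(* The energy b x x - 2 f x is bounded below; by the parallelogram identity its
   minimising sequences are Cauchy, and their first variation tends to 0. *)
Lemma psd_riesz (f : E -> R) (C : R) : 0 <= C ->
  (forall a x y, V x -> V y -> f (a *: x + y) = a * f x + f y) ->
  (forall x, V x -> f x ^+ 2 <= C * b x x) ->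
  exists u : nat -> E, [/\ forall n, V (u n), psd_cauchy u &
    forall v, V v -> b (u n) v @[n --> \oo] --> f v].
Proof.
move=> C0 fP fC; pose J x := b x x - 2 * f x.
have V0 := psdV0 bP.
have Jge x : V x -> - C <= J x.
  move=> Vx; have := fC x Vx; have := psd_ge0 bP Vx => b0 fb.
  rewrite /J; have [?|lt] := leP (2 * f x) (b x x + C); first lra.
  (* Otherwise (b + C)^2 < 4 f^2 <= 4 C b, against (b - C)^2 >= 0. *)
  have : (b x x + C) ^+ 2 < (2 * f x) ^+ 2 by rewrite ltrXn2r//; lra.
  have := sqr_ge0 (b x x - C); rewrite !expr2 => *; nra.
have hJ : has_inf (J @` V).
  split; first by exists (J 0), 0.
  by exists (- C) => _ [x Vx <-]; exact: Jge.
pose m := inf (J @` V).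
have Jm x : V x -> m <= J x by move=> Vx; apply: (ge_inf hJ.2); exists x.
have /choice[u uP] : forall n, exists x, V x /\ J x < m + n.+1%:R^-1.
  move=> n; have [] := @inf_adherent _ (J @` V) n.+1%:R^-1 _ hJ.
    by rewrite invr_gt0.
  by move=> _ [x Vx <-] h; exists x.
have Vu n : V (u n) by case: (uP n).
have Ju n : J (u n) < m + n.+1%:R^-1 by case: (uP n).
exists u; split => // [e e0|v Vv].
  (* With both energies below m + e / 4 and the midpoint above m, the parallelogram identity leaves
     4 (m + e / 4) - 4 m = e. *)
  have [N HN] : exists N : nat, N.+1%:R^-1 <= e / 4.
    have := @near_infty_natSinv_lt R (PosNum (divr_gt0 e0 (ltr0n R 4))).
    by case=> N _ /(_ N (leqnn N)) /= h; exists N; exact: ltW.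
  exists N => p q Np Nq.
  have small r : (N <= r)%N -> J (u r) <= m + e / 4.
    move=> Nr; apply: (le_trans (ltW (Ju r))); rewrite lerD2l.
    by apply: le_trans HN; rewrite lef_pV2 ?posrE// ler_nat ltnS.
  have par x y : V x -> V y -> b (x - y) (x - y) =
      2 * J x + 2 * J y - 4 * J (2^-1 *: (x + y)).
    move=> Vx Vy; have Vxy := psdVD Vx Vy.
    rewrite /J psdZl//; last exact: psdVZ.
    rewrite (psdC bP Vxy); last exact: psdVZ.
    rewrite psdZl//.
    have -> : f (2^-1 *: (x + y)) = 2^-1 * (f x + f y).
      rewrite -[2^-1 *: _]addr0 fP//.
      have f0 : f 0 = 0.
        by have := fP 1 0 0 V0 V0; rewrite scale1r addr0; lra.
      by rewrite f0 addr0 -{1}[x]scale1r fP// mul1r.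
    have -> : x - y = -1 *: y + x by rewrite scaleN1r addrC.
    have -> : b (x + y) (x + y) = b x x + 2 * b x y + b y y.
      by rewrite -{1 2}[x]scale1r psd_sqr//; ring.
    rewrite psd_sqr// (psdC bP Vy Vx); lra.
  rewrite par//.
  have := Jm _ (psdVZ 2^-1 (psdVD (Vu p) (Vu q))).
  by have := small p Np; have := small q Nq; lra.
(* J (t v + u n) >= m > J (u n) - 1 / (n + 1) for every t is a nonnegative quadratic in t; this is
   its discriminant. *)
have var n : (b (u n) v - f v) ^+ 2 <= b v v * n.+1%:R^-1.
  apply: (@discriminant_le0 (b v v) _ n.+1%:R^-1); first exact: psd_ge0.
  move=> t; have := Jm _ (psdVP bP t Vv (Vu n)); have := Ju n.
  rewrite /J psd_sqr// fP// (psdC bP Vv (Vu n)); move: (_^-1) => i; lra.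
apply/cvgrPdist_le => /= e e0.
have bv : 0 <= b v v := psd_ge0 bP Vv.
(* The threshold is e^2 / (b v v + 1), the 1 covering the case b v v = 0. *)
have [N _ HN] := @near_infty_natSinv_lt R (PosNum (divr_gt0 (exprn_gt0 2 e0)
   (ltr_wpDl bv ltr01))).
exists N => // n /= /HN /= h.
rewrite -ler_sqr ?nnegrE ?(ltW e0)// real_normK ?num_real// -sqrrN opprB.
apply: (le_trans (var n)).
have n0 : 0 < n.+1%:R^-1 :> R by rewrite invr_gt0.
have b1 : 0 < b v v + 1 by lra.
move: h; rewrite ltr_pdivlMr//.
clear HN; move: n0 bv; move: (_^-1) (b v v) (e ^+ 2) => i c w *; nra.
Qed.

End psd_form.

(** * Square-integrable functions *)

Section L2.
Context d (T : measurableType d) (R : realType) (P : probability T R).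
Local Notation L2 := (Lfun P 2%:E).
Implicit Types u v w : T -> R.

Definition ip u v : R := (\int[P]_x (u x * v x))%R.

Lemma Lfun2P u : u \in L2 <->
  measurable_fun setT u /\ P.-integrable setT (EFin \o (fun x => u x ^+ 2)).
Proof.
split=> [uL|[mu iu]].
  split; last exact: Lfun2_integrable_sqr.
  by move: uL; rewrite inE => /andP[/[!inE]].
rewrite inE; apply/andP; split; rewrite inE//=.
rewrite /finite_norm unlock /=.
rewrite poweR_lty//.
have /integrableP[miu iuy] := iu; apply: le_lt_trans iuy.
apply: ge0_le_integral => //=.
- apply/measurable_EFinP; apply: (measurableT_comp (measurable_powR _)).
  exact: measurableT_comp.
- apply/measurable_EFinP; apply: measurableT_comp => //.
  exact: measurable_funX.
- by move=> x _; rewrite lee_fin powR_mulrn// normrX.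
Qed.

Lemma measurable_Lfun2 u : u \in L2 -> measurable_fun setT u.
Proof. by case/Lfun2P. Qed.

Lemma integrable_Lfun2M u v : u \in L2 -> v \in L2 ->
  P.-integrable setT (EFin \o (fun x => u x * v x)).
Proof. by move=> uL vL; apply/Lfun1_integrable; exact: Lfun2_mul_Lfun1. Qed.

Lemma integrable_Lfun2 u : u \in L2 -> P.-integrable setT (EFin \o u).
Proof.
move=> uL; apply/Lfun1_integrable; apply: Lfun_subset12 => //.
exact: fin_num_measure.
Qed.

Lemma Lfun2_lin a u v : u \in L2 -> v \in L2 -> a *: u + v \in L2.
Proof.
move=> uL vL; have [_ /(_ a u v)] := @Lfun_submod_closed _ _ _ P 2%:E (lee1n 2).
exact.
Qed.

Lemma Lfun2_0 : (0 : T -> R) \in L2.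
Proof. by have [] := @Lfun_submod_closed _ _ _ P 2%:E (lee1n 2). Qed.

Lemma Lfun2B u v : u \in L2 -> v \in L2 -> u - v \in L2.
Proof. by move=> uL vL; rewrite addrC -scaleN1r; exact: Lfun2_lin. Qed.

Lemma ip_psd_form : psd_form [set u | u \in L2] ip.
Proof.
split => /=.
- exact: Lfun2_0.
- by move=> a u v uL vL; exact: Lfun2_lin.
- by move=> u v _ _; apply: eq_Rintegral => x _; rewrite mulrC.
- move=> a u v w uL vL wL; rewrite /ip.
  rewrite -RintegralZl//; last exact: integrable_Lfun2M.
  rewrite -RintegralD//; last exact: integrable_Lfun2M.
    by apply: eq_Rintegral => x _; rewrite mulrDl mulrA.
  exact: integrableZl (integrable_Lfun2M uL wL).
- by move=> u uL; apply: Rintegral_ge0 => x _; rewrite -expr2 sqr_ge0.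
Qed.

Lemma ip_cst1 u : ip u (cst 1) = (\int[P]_x u x)%R.
Proof. by apply: eq_Rintegral => x _; rewrite /= mulr1. Qed.

Lemma Lfun2_cst (c : R) : (cst c : T -> R) \in L2.
Proof. exact: Lfun_cst. Qed.

Lemma ip_cst1_1 : ip (cst 1) (cst 1) = 1.
Proof.
rewrite ip_cst1 /= Rintegral_cst//.
by rewrite [X in fine X](_ : _ = 1%E) ?mulr1//; exact: probability_setT.
Qed.

Lemma Lfun2_norm u : u \in L2 -> (fun x => `|u x|) \in L2.
Proof.
move=> /Lfun2P[mu iu]; apply/Lfun2P; split; first exact: measurableT_comp.
apply: eq_integrable iu => // x _ /=.
by rewrite real_normK ?num_real.
Qed.

(** Cauchy-Schwarz against the constant 1, of norm 1 for a probability. *)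
Lemma sqr_integral_le u : u \in L2 -> (\int[P]_x `|u x|)%R ^+ 2 <= ip u u.
Proof.
move=> uL; rewrite -ip_cst1.
have := psd_CauchySchwarz ip_psd_form (Lfun2_norm uL) (Lfun2_cst 1).
rewrite ip_cst1_1 mulr1 => /le_trans; apply.
rewrite le_eqVlt; apply/orP; left; apply/eqP; apply: eq_Rintegral => x _ /=.
by rewrite -!expr2 real_normK ?num_real.
Qed.

Lemma ipE u : u \in L2 -> (ip u u)%:E = (\int[P]_x (u x ^+ 2)%:E)%E.
Proof.
move=> /Lfun2P[_ iu]; rewrite /ip /Rintegral fineK//.
exact: integrable_fin_num iu.
Qed.

Lemma ip_eq0 u : u \in L2 -> ip u u = 0 -> {ae P, forall x, u x = 0}.
Proof.
move=> uL u0; have := ipE uL; rewrite u0 => /esym h.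
have [mu iu] := (Lfun2P u).1 uL.
have mu2 : measurable_fun setT (EFin \o (fun x => u x ^+ 2)).
  by apply/measurable_EFinP; exact: measurable_funX.
have [+ _] := @ae_eq_integral_abs _ _ _ P setT measurableT _ mu2.
have i0 : (\int[P]_x `|(EFin \o (fun x => u x ^+ 2)%R) x| = 0)%E.
  by rewrite -[RHS]h; apply: eq_integral => x _ /=; rewrite ger0_norm ?sqr_ge0.
move=> /(_ i0)[N [mN N0 sN]]; exists N; split => // x /= ux; apply: sN => /=.
by move=> /(_ I)[] /eqP; rewrite sqrf_eq0 => /eqP.
Qed.

(* The limit is computed pointwise from the values of the sequence, so that it
   is periodic as soon as all the terms are. *)
Lemma Lfun2_complete (u : nat -> T -> R) : (forall n, u n \in L2) ->
  psd_cauchy ip u ->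
  exists F : (nat -> R) -> R, (fun x => F (u ^~ x)) \in L2 /\
    ip (u n - (fun x => F (u ^~ x))) (u n - (fun x => F (u ^~ x)))
      @[n --> \oo] --> (0 : R).
Proof.
(* The [c k] add up to 1. They will bound the L^1 norms of the increments along a subsequence, which
   makes these increments absolutely summable almost everywhere. *)
move=> uL uC; pose c k : R := 1 / (2 ^ (k + 1))%:R.
have c0 k : 0 < c k by rewrite divr_gt0// ltr0n expn_gt0.
have /choice[N NP] : forall k : nat, exists N, forall m n,
  (N <= m)%N -> (N <= n)%N ->
    ip (u m - u n) (u m - u n) <= (c k) ^+ 2.
  by move=> k; apply: uC; exact: exprn_gt0.
(* Summing all the [N j] makes [phi] monotone and at least [N k]; the term k gives phi k >= k, used
   after Fatou's lemma. *)
pose phi k := (k + \sum_(j < k.+1) N j)%N.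
have phiN k : (N k <= phi k)%N.
  by rewrite /phi big_ord_recr /= addnA leq_addl.
have phiS k : (phi k <= phi k.+1)%N.
  by rewrite /phi (big_ord_recr k.+1)/= leq_add// leq_addr.
pose D k : T -> R := u (phi k.+1) - u (phi k).
have DL k : D k \in L2 by exact: Lfun2B.
have intD k : (\int[P]_x `|D k x|%:E <= (c k)%:E)%E.
  have iD := integrable_Lfun2 (Lfun2_norm (DL k)).
  rewrite -[leLHS]fineK ?lee_fin; last exact: integrable_fin_num iD.
  rewrite -ler_sqr ?nnegrE ?(ltW (c0 _))//; last first.
    exact: Rintegral_ge0.
  apply: le_trans (sqr_integral_le (DL k)) _; apply: NP => //.
  exact: leq_trans (phiS k).
pose g x := (\sum_(k <oo) `|D k x|%:E)%E.
have mD k : measurable_fun setT (fun x => `|D k x|%:E).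
  apply/measurable_EFinP; apply: measurableT_comp => //.
  exact: measurable_Lfun2.
have gint : (\int[P]_x g x < +oo)%E.
  rewrite integral_nneseries//.
  apply: (@le_lt_trans _ _ (\sum_(k <oo) (c k)%:E)%E).
    by apply: lee_nneseries => k _; [move=> _; apply: integral_ge0|exact: intD].
  suff -> : (\sum_(k <oo) (c k)%:E)%E = 1%:E by rewrite ltry.
  apply/cvg_lim => //; have := @cvg_geometric_eseries_half R 1 0.
  by rewrite expr0 divr1.
have gae : {ae P, forall x, setT x -> g x \is a fin_num}.
  apply: integrable_ae => //; apply/integrableP; split.
    exact: ge0_emeasurable_sum.
  apply: le_lt_trans gint; rewrite le_eqVlt; apply/orP; left; apply/eqP.
  by apply: eq_integral => x _; rewrite gee0_abs// nneseries_ge0.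
have cvgae : {ae P, forall x, cvgn (fun k => u (phi k) x)}.
  apply: filterS gae => x /(_ I) gx.
  pose a := telescope (fun k => u (phi k) x).
  suff /cvg_ex[l al] : cvgn (series a).
    apply/cvg_ex; exists (u (phi 0%N) x + l).
    rewrite (_ : (fun k => _) = (fun k => u (phi 0%N) x + series a k)).
      by apply: cvgD => //; exact: cvg_cst.
    by apply/funext => k; rewrite -eq_sum_telescope.
  apply: normed_cvg; apply: nondecreasing_is_cvgn.
    by apply: nondecreasing_series => *; exact: normr_ge0.
  exists (fine (g x)) => _ [k _ <-]; rewrite -lee_fin fineK//.
  have := @nneseries_lim_ge R (fun k => `|D k x|%:E) xpredT 0 k.
  rewrite sumEFin => /(_ _); apply => n _ _; by rewrite lee_fin.
(* An upper limit exists for every sequence and is measurable in x; it is the limit wherever the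
   subsequence converges, and [fine] turns infinite values into 0. *)
pose F (s : nat -> R) := fine (limn_esup (fun k => (s (phi k))%:E)).
exists F; set w : T -> R := fun x => _.
have wae : {ae P, forall x, u (phi k) x @[k --> \oo] --> w x}.
  apply: filterS cvgae => x cx; rewrite /w /F.
  have /cvg_ex[l ul] := cx.
  have ulE : (u (phi k) x)%:E @[k --> \oo] --> l%:E.
    by apply/fine_cvgP; split => //; exact: nearW.
  by rewrite (cvg_limn_einf_sup ulE).
have mw : measurable_fun setT w.
  apply: measurableT_comp => //; apply: measurable_fun_limn_esup => k.
  by apply/measurable_EFinP; exact: measurable_Lfun2.
(* Fatou's lemma in k, for fixed n, carries the Cauchy bound on u n - u (phi k) over to u n - w. *)
have fatou_w (e : R) : 0 < e -> exists M, forall n, (M <= n)%N ->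
    (\int[P]_x ((u n x - w x) ^+ 2)%:E <= e%:E)%E.
  move=> e0; have [M MP] := uC e e0; exists M => n Mn.
  have mun k : measurable_fun setT (fun x => ((u n x - u (phi k) x) ^+ 2)%:E).
    apply/measurable_EFinP; apply: measurable_funX.
    by apply: measurable_funB; exact: measurable_Lfun2.
  have pos k x : setT x -> (0 <= ((u n x - u (phi k) x) ^+ 2)%:E)%E.
    by move=> _; rewrite lee_fin sqr_ge0.
  have fat := fatou P measurableT mun pos.
  apply: (le_trans (le_trans _ fat)).
    apply: ae_ge0_le_integral => //.
    - by move=> x _; rewrite lee_fin sqr_ge0.
    - apply/measurable_EFinP; apply: measurable_funX.
      by apply: measurable_funB => //; exact: measurable_Lfun2.
    - move=> x _; rewrite limn_einf_lim; apply: lime_ge;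
        first exact: is_cvg_einfs.
      apply: nearW => k; apply: le_ereal_inf_tmp => _ [m _ <-].
      exact: pos.
    - apply: measurableT_comp => //; apply: measurable_fun_limn_esup => k.
      exact: measurableT_comp.
    - apply: filterS wae => x wx _.
      have : ((u n x - u (phi k) x) ^+ 2)%:E @[k --> \oo] --> ((u n x - w x) ^+
        2)%:E.
        apply/fine_cvgP; split; first exact: nearW.
        rewrite /= expr2; under eq_fun do rewrite expr2.
        by apply: cvgM; apply: cvgB => //; exact: cvg_cst.
      by move/cvg_limn_einf_sup => [-> _].
  rewrite limn_einf_lim; apply: lime_le; first exact: is_cvg_einfs.
  apply: nearW => k; apply: ge_ereal_inf.
  (* The index must be at least k to enter the tail infimum and at least M for the Cauchy bound. *)
  exists (\int[P]_x ((u n x - u (phi (maxn k M)) x) ^+ 2)%:E)%E.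
    by exists (maxn k M) => //=; exact: leq_maxl.
  rewrite -(ipE (Lfun2B (uL n) (uL _))) lee_fin; apply: MP => //.
  apply: (leq_trans (leq_maxr k M)); exact: leq_addr.
have wL : w \in L2.
  have [M /(_ M (leqnn M)) h] := fatou_w 1 ltr01.
  rewrite (_ : w = u M - (u M - w)); last by rewrite opprB addrC subrK.
  apply: Lfun2B => //; apply/Lfun2P; split.
    by apply: measurable_funB => //; exact: measurable_Lfun2.
  apply/integrableP; split.
    apply/measurable_EFinP; apply: measurable_funX.
    by apply: measurable_funB => //; exact: measurable_Lfun2.
  apply: (@le_lt_trans _ _ 1%:E); last by rewrite ltry.
  apply: le_trans h; rewrite le_eqVlt; apply/orP; left; apply/eqP.
  by apply: eq_integral => x _; rewrite gee0_abs// lee_fin sqr_ge0.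
split => //; apply/cvgrPdist_le => /= e e0.
have [M hM] := fatou_w e e0; exists M => // n /= Mn.
rewrite sub0r normrN ger0_norm; last exact: (psd_ge0 ip_psd_form (Lfun2B (uL n)
  wL)).
by rewrite -lee_fin ipE; [exact: hM|exact: Lfun2B].
Qed.

Lemma Rintegral_ae (f g : T -> R) : measurable_fun setT f -> measurable_fun
  setT g ->
  {ae P, forall x, f x = g x} -> \int[P]_x f x = \int[P]_x g x.
Proof.
move=> mf mg [N [mN N0 sN]]; rewrite /Rintegral; congr fine;
  apply: ae_eq_integral => //.
- exact/measurable_EFinP.
- exact/measurable_EFinP.
- by exists N; split => // x /= h; apply: sN => /= fg; apply: h => _;
    rewrite fg.
Qed.

Lemma ip_cvg (u : nat -> T -> R) w v : (forall n, u n \in L2) -> w \in L2 ->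
  v \in L2 -> ip (u n - w) (u n - w) @[n --> \oo] --> (0 : R) ->
  ip (u n) v @[n --> \oo] --> ip w v.
Proof.
move=> uL wL vL /cvgrPdist_le uw; have B := ip_psd_form.
have v0 : 0 <= ip v v := psd_ge0 B vL.
apply/cvgrPdist_le => /= e e0.
have e2 : 0 < e ^+ 2 / (ip v v + 1) by rewrite divr_gt0 ?exprn_gt0// ltr_wpDl.
apply: filterS (uw _ e2) => n /=; have uwL := Lfun2B (uL n) wL.
rewrite sub0r normrN ger0_norm; last exact: (psd_ge0 B uwL).
move=> h; rewrite distrC -(psdBl B (uL n) wL vL).
rewrite -ler_sqr ?nnegrE ?(ltW e0)// real_normK ?num_real//.
apply: (le_trans (psd_CauchySchwarz B uwL vL)).
move: h; rewrite ler_pdivlMr; last by rewrite ltr_wpDl.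
move: (psd_ge0 B uwL) v0; move: (ip (_ - _) _) (ip v v) (e ^+ 2) => a b c *;
  nra.
Qed.

End L2.

(** * Trigonometric functions on the unit interval *)

Section mrestr_integral.
Local Open Scope ereal_scope.
Context d (T : measurableType d) (R : realType) (mu : {measure set T -> \bar
  R}).

Lemma integral_mrestr (D : set T) (mD : measurable D) (f : T -> \bar R) :
  measurable_fun setT f -> \int[mrestr mu mD]_x f x = \int[mu]_(x in D) f x.
Proof.
move=> mf; transitivity (\int[mrestr mu mD]_(x in D) f x); last first.
  apply: eq_measure_integral => A mA AD.
  by rewrite /= /mrestr setIidl.
rewrite [RHS]integral_mkcond; apply: ae_eq_integral => //.
  apply/(measurable_restrictT _ mD); exact: measurable_funTS.
exists (~` D); split; first exact: measurableC.
  by rewrite /= /mrestr setICl measure0.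
move=> x /= h Dx; apply: h => _; rewrite patchE mem_set//.
Qed.

Lemma integrable_mrestr (D : set T) (mD : measurable D) (f : T -> \bar R) :
  measurable_fun setT f ->
  (mrestr mu mD).-integrable setT f <-> mu.-integrable D f.
Proof.
move=> mf; split=> /integrableP[_ h]; apply/integrableP; split.
- exact: measurable_funTS.
- by rewrite -integral_mrestr//; exact: measurableT_comp.
- by [].
- by rewrite integral_mrestr//; exact: measurableT_comp.
Qed.
End mrestr_integral.

Section unit_interval.
Context (R : realType).
Local Notation lambda := (@unit_lebesgue R).

(* The functions cas (2 pi k x), k an integer, form a real orthonormal family
   whose products and derivatives are again combinations of such functions. *)
Definition cas (k : int) (x : R) : R :=
  cos (2 * pi * k%:~R * x) + sin (2 * pi * k%:~R * x).

(** With angles a and b, the product is cos (a - b) + sin (a + b); the two halves are the even part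
    of [cas] at k - l and its odd part at k + l. *)
Lemma casM k l x : cas k x * cas l x =
  (cas (k - l) x + cas (l - k) x) / 2 + (cas (k + l) x - cas (- (k + l)) x) / 2.
Proof.
rewrite /cas !rmorphB rmorphN !rmorphD/=.
set a := 2 * pi * k%:~R * x; set b := 2 * pi * l%:~R * x.
have -> : 2 * pi * (k%:~R - l%:~R) * x = a - b by rewrite /a /b; ring.
have -> : 2 * pi * (l%:~R - k%:~R) * x = - (a - b) by rewrite /a /b; ring.
have -> : 2 * pi * - (k%:~R + l%:~R) * x = - (a + b) by rewrite /a /b; ring.
have -> : 2 * pi * (k%:~R + l%:~R) * x = a + b by rewrite /a /b; ring.
rewrite !cosN !sinN cosB (sinD a b). by field.
Qed.

Lemma casD1 k x : cas k (x + 1) = cas k x.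
Proof.
have perZ (f : R -> R) : periodic f (pi *+ 2) -> forall y,
    f (y + pi *+ 2 * k%:~R) = f y.
  move=> pf y; case: k => n.
    by rewrite -pmulrn mulr_natr (periodicn pf).
  rewrite NegzE mulrNz mulrN -pmulrn mulr_natr -{2}[y](subrK ((pi *+ 2) *+
    n.+1)).
  by rewrite (periodicn pf).
rewrite /cas.
have -> : 2 * pi * k%:~R * (x + 1) = 2 * pi * k%:~R * x + pi *+ 2 * k%:~R :> R.
  by rewrite -mulr_natl; ring.
by rewrite (perZ _ (@cosD2pi R)) (perZ _ (@sinD2pi R)).
Qed.

Lemma cas0 x : cas 0 x = 1.
Proof. by rewrite /cas mulr0 mul0r cos0 sin0 addr0. Qed.

Lemma cas_le2 k x : `|cas k x| <= 2.
Proof.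
apply: (le_trans (ler_normD _ _)).
have := cos_max (2 * pi * k%:~R * x); have := sin_max (2 * pi * k%:~R * x); lra.
Qed.

Lemma is_derive_cas k x :
  is_derive (x : R) 1 (cas k) (2 * pi * k%:~R * cas (- k) x).
Proof.
rewrite /cas rmorphN/= mulrN mulNr cosN sinN.
set c := 2 * pi * k%:~R.
have dc : is_derive x 1 (fun y => c * y) c.
  by apply: is_derive_eq; rewrite /GRing.scale/= !mulr1.
have d1 := @is_derive1_comp R cos _ x _ c (is_derive_cos (c * x)) dc.
have d2 := @is_derive1_comp R sin _ x _ c (is_derive_sin (c * x)) dc.
by apply: is_derive_eq (is_deriveD d1 d2) _; ring.
Qed.

Lemma continuous_cas k : continuous (cas k).
Proof.
move=> x; apply/differentiable_continuous/derivable1_diffP.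
by have [] := is_derive_cas k x.
Qed.

Lemma measurable_cas k : measurable_fun setT (cas k).
Proof. by apply: continuous_measurable_fun; exact: continuous_cas. Qed.

(** Constants are included as multiples of [cas 0]. *)
Inductive trigpoly : (R -> R) -> Prop :=
| trigpoly_cas k : trigpoly (cas k)
| trigpolyD p q : trigpoly p -> trigpoly q -> trigpoly (fun x => p x + q x)
| trigpolyZ a p : trigpoly p -> trigpoly (fun x => a * p x).

Lemma trigpolyM p q : trigpoly p -> trigpoly q -> trigpoly (fun x => p x * q x).
Proof.
move=> tp; elim: tp q => [k|p1 p2 _ ih1 _ ih2|a p1 _ ih] q tq.
- elim: tq => [l|q1 q2 _ ih1 _ ih2|a q1 _ ih].
  + rewrite (_ : (fun x => _) = (fun x => (2^-1 * cas (k - l) x + 2^-1 * cas (l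
      - k) x) +
     (2^-1 * cas (k + l) x + (- 2^-1) * cas (- (k + l)) x))).
      by do !(exact: trigpoly_cas || apply: trigpolyZ || apply: trigpolyD).
    by apply/funext => x; rewrite casM; field.
  + rewrite (_ : (fun x => _) = (fun x => cas k x * q1 x + cas k x * q2 x)).
      exact: trigpolyD.
    by apply/funext => x; rewrite mulrDr.
  + rewrite (_ : (fun x => _) = (fun x => a * (cas k x * q1 x))).
      exact: trigpolyZ.
    by apply/funext => x; rewrite mulrCA.
- rewrite (_ : (fun x => _) = (fun x => p1 x * q x + p2 x * q x)).
    by apply: trigpolyD; [exact: ih1|exact: ih2].
  by apply/funext => x; rewrite mulrDl.
- rewrite (_ : (fun x => _) = (fun x => a * (p1 x * q x))).
    by apply: trigpolyZ; exact: ih.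
  by apply/funext => x; rewrite mulrA.
Qed.

End unit_interval.

(** * Integrals against bounded functions, and finite sums *)

Section integral_extra.
Context d (T : measurableType d) (R : realType) (mu : {measure set T -> \bar
  R}).

Lemma integrable_measurable (f : T -> R) :
  mu.-integrable setT (EFin \o f) -> measurable_fun setT f.
Proof. by move=> fi; apply/measurable_EFinP; exact: measurable_int fi. Qed.

Lemma integrableM_bounded (f h : T -> R) (M : R) :
  mu.-integrable setT (EFin \o f) -> measurable_fun setT h ->
  (forall x, `|h x| <= M) -> mu.-integrable setT (EFin \o (fun x => f x * h x)).
Proof.
move=> fi mh hM.
have mf := integrable_measurable fi.
have := integrableZl measurableT M fi; apply: le_integrable => //.
  by apply/measurable_EFinP; exact: measurable_funM.
move=> x _ /=; rewrite lee_fin !normrM mulrC ler_wpM2r//.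
by apply: le_trans (hM x) _; exact: ler_norm.
Qed.

(** Orthogonality to an integrable f survives bounded pointwise limits: M |f| dominates. *)
Lemma dominated_cvg0_Rintegral (f : T -> R) (h : nat -> T -> R) (h0 : T -> R)
  (M : R) :
  mu.-integrable setT (EFin \o f) -> (forall n, measurable_fun setT (h n)) ->
  (forall n x, `|h n x| <= M) -> (forall x, h n x @[n --> \oo] --> h0 x) ->
  (forall n, \int[mu]_x (f x * h n x) = 0) -> \int[mu]_x (f x * h0 x) = 0.
Proof.
move=> fi mh hM hh0 fh0.
have mf := integrable_measurable fi.
have mfh n : measurable_fun setT (fun x => (f x * h n x)%:E).
  by apply/measurable_EFinP; exact: measurable_funM.
have mfh0 : measurable_fun setT (fun x => (f x * h0 x)%:E).
  apply/measurable_EFinP; apply: measurable_funM => //.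
  exact: measurable_fun_cvg mh (fun x _ => hh0 x).
have [|||_ _] := @dominated_convergence _ _ _ mu setT measurableT _ _
  (fun x => (M * `|f x|)%:E) mfh mfh0.
- apply: nearW => x _; apply: cvg_EFin; first exact: nearW.
  by apply: cvgM => //; exact: cvg_cst.
- have := integrableZl measurableT M (integrable_norm fi);
    apply: eq_integrable => //.
- by apply: nearW => x n _; rewrite lee_fin normrM mulrC ler_wpM2r.
rewrite (_ : (fun n => _) = cst 0%E); last first.
  apply/funext => n; rewrite -[LHS]fineK; first by rewrite [fine _]fh0.
  exact: integrable_fin_num (integrableM_bounded fi (mh n) (hM n)).
by rewrite /Rintegral => /(cvg_unique _ (cvg_cst _)) <-.
Qed.

Lemma integrable_if (D : set T) (f : T -> R) : measurable D ->
  mu.-integrable D (EFin \o f) ->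
  mu.-integrable setT (EFin \o (fun x => if x \in D then f x else 0)).
Proof.
move=> mD /(integrable_mkcond _ mD).1; apply: eq_integrable => // x _ /=.
by rewrite patchE; case: ifP.
Qed.

Lemma measurable_fun_if0 (D : set T) (f : T -> R) : measurable D ->
  measurable_fun setT f -> measurable_fun setT (fun x =>
    if x \in D then f x else 0).
Proof.
move=> mD mf; rewrite (_ : (fun x => _) = (fun x => f x * \1_D x)).
  by apply: measurable_funM => //; exact: measurable_indic.
by apply/funext => x; rewrite indicE; case: (x \in D); rewrite ?mulr1 ?mulr0.
Qed.

Lemma integrable_Rsum I (r : seq I) (f : I -> T -> R) :
  (forall i, mu.-integrable setT (EFin \o f i)) ->
  mu.-integrable setT (EFin \o (fun x => \sum_(i <- r) f i x)).
Proof.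
move=> fi; elim: r => [|i r ih].
  by under eq_fun do rewrite big_nil; exact: (integrable0 mu setT).
rewrite (_ : _ \o _ = (EFin \o f i) \+ (EFin \o (fun x =>
  \sum_(j <- r) f j x))).
  exact: integrableD.
by apply/funext => x /=; rewrite big_cons.
Qed.

Lemma Rintegral_sum I (r : seq I) (f : I -> T -> R) :
  (forall i, mu.-integrable setT (EFin \o f i)) ->
  \int[mu]_x (\sum_(i <- r) f i x) = \sum_(i <- r) \int[mu]_x f i x.
Proof.
move=> fi; elim: r => [|i r ih].
  by under eq_Rintegral do rewrite big_nil; rewrite Rintegral_cst// mul0r
    big_nil.
rewrite big_cons -ih; under eq_Rintegral do rewrite big_cons.
by rewrite RintegralD//; exact: integrable_Rsum.
Qed.

Lemma Rintegral_if (D : set T) (f : T -> R) :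
  \int[mu]_(x in D) f x = \int[mu]_x (if x \in D then f x else 0).
Proof. by rewrite Rintegral_mkcond; apply: eq_Rintegral => x _;
  rewrite patchE. Qed.
End integral_extra.

(** * A polynomial iteration converging to the sign on [-1, 1] *)

Section sign_iteration.
Context (R : realType).
Implicit Types t : R.

(** The cubic is odd and maps [-1, 1] to itself; it fixes 0 with slope 3/2 and fixes 1 and -1 with
    slope 0, so it repels from 0 towards the sign. Being a polynomial, it preserves trigonometric
    polynomials. *)
Definition sgnit (n : nat) t : R := iter n (fun t => (3 * t - t ^+ 3) / 2) t.

Lemma sgnitS n t : sgnit n.+1 t = (3 * sgnit n t - sgnit n t ^+ 3) / 2.
Proof. by []. Qed.

Lemma sgnitN n t : sgnit n (- t) = - sgnit n t.
Proof. by elim: n => // n ih; rewrite !sgnitS ih; field. Qed.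

Lemma sgnit_ge n t : 0 <= t <= 1 -> t <= sgnit n t <= 1.
Proof.
move=> /andP[t0 t1]; elim: n => [|n]; first by rewrite lexx.
rewrite sgnitS; move: (sgnit n t) => s /andP[ts s1]; apply/andP; split.
  (* Twice the increase of s under the cubic. *)
  have : 0 <= s * (1 - s) * (1 + s) by rewrite !mulr_ge0//; lra.
  lra.
(* Twice the distance from the new value to 1. *)
have : 0 <= (1 - s) ^+ 2 * (2 + s) by rewrite mulr_ge0// ?sqr_ge0//; lra.
lra.
Qed.

Lemma sgnit_rate n t : 0 <= t <= 1 -> 1 - sgnit n t <= (1 - t / 2) ^+ n.
Proof.
move=> t01; elim: n => [|n ih]; first by rewrite expr0 /=; case/andP: t01; lra.
have := sgnit_ge n t01; rewrite sgnitS (exprS (1 - t / 2)).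
move: (sgnit n t) (_ ^+ n) ih => s r ih /andP[ts s1]; case/andP: t01 => t0 t1.
have : 0 <= (1 - t / 2) * (r - (1 - s)) by rewrite mulr_ge0//; lra.
have : 0 <= (1 - s) * (s - t) by rewrite mulr_ge0//; lra.
have : 0 <= (1 - s) * s ^+ 2 by rewrite mulr_ge0// ?sqr_ge0//; lra.
lra.
Qed.

Lemma sgnit_cvg t : `|t| <= 1 -> sgnit n t @[n --> \oo] --> Num.sg t.
Proof.
have pos s : 0 < s -> s <= 1 -> sgnit n s @[n --> \oo] --> (1 : R).
  move=> s0 s1.
  have g : (fun n => 1 - (1 - s / 2) ^+ n : R) @ \oo --> (1 - 0 : R).
    apply: cvgB; [exact: cvg_cst|apply: cvg_expr].
    by rewrite ger0_norm; lra.
  rewrite subr0 in g; apply: (@squeeze_cvgr nat \oo _ R (fun n =>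
    1 - (1 - s / 2) ^+ n) (cst 1)).
  apply: nearW => n /=; have s01 : 0 <= s <= 1 by rewrite s1 ltW.
  have := sgnit_rate n s01.
  by have /andP[_ ->] := sgnit_ge n s01; rewrite andbT; lra.
  exact: g.
  exact: cvg_cst.
move=> t1; have [t0|t0|<-] := ltrgtP 0 t.
- rewrite gtr0_sg//; apply: pos => //; exact: le_trans (ler_norm _) t1.
- rewrite ltr0_sg//; rewrite -[t]opprK; under eq_fun do rewrite sgnitN.
  apply: cvgN; apply: pos; first by rewrite oppr_gt0.
  by rewrite -normrN in t1; exact: le_trans (ler_norm _) t1.
- rewrite sgr0 (_ : (fun n => _) = cst 0); first exact: cvg_cst.
  by apply/funext; elim=> // n ih; rewrite sgnitS ih expr0n/=; field.
Qed.

Lemma sgnit_le1 n t : `|t| <= 1 -> `|sgnit n t| <= 1.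
Proof.
have pos s : 0 <= s -> s <= 1 -> `|sgnit n s| <= 1.
  move=> s0 s1; have /(sgnit_ge n)/andP[h1 h2] : 0 <= s <= 1 by rewrite s0.
  by rewrite ger0_norm//; exact: le_trans h1.
have [t0|t0] := leP 0 t; first by rewrite ger0_norm//; exact: pos.
rewrite ltr0_norm// => t1; rewrite -[t]opprK sgnitN normrN; apply: pos => //.
by rewrite oppr_ge0 ltW.
Qed.

End sign_iteration.

(** * Totality in dimension one *)

Section totality1.
Context (R : realType).
Local Notation lambda := (@unit_lebesgue R).
Local Notation leb := (@lebesgue_measure R).

(* Positive on (0, b) and negative on (b, 1), see qarcE; the iterates of
   t |-> (3 t - t^3) / 2 turn it into its sign. *)
Definition qarc (b x : R) : R :=
  (cos (pi * b) / 4 * (cas 1 x + cas (-1) x)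
   + sin (pi * b) / 4 * (cas 1 x + (-1) * cas (-1) x))
  + (- cos (pi * b) / 2) * cas 0 x.

(** Each sine has half-integer frequency, but their product is (cos (2 pi x - pi b) - cos (pi b)) /
    2, of frequencies 0 and 1. *)
Lemma qarcE b x : qarc b x = sin (pi * x) * sin (pi * (b - x)).
Proof.
have cN : cas (-1) x = cos (2 * pi * x) - sin (2 * pi * x).
  by rewrite /cas mulrN1z mulrN1 mulNr cosN sinN.
rewrite /qarc cas0 cN /cas mulr1z mulr1.
set y := pi * x; set c := pi * b.
have -> : 2 * pi * x = y + y by rewrite /y; ring.
have -> : pi * (b - x) = c - y by rewrite /y /c; ring.
rewrite sinB cosD sinD.
have := cos2Dsin2 y; set C := cos y; set S := sin y => CS.
have -> : C * C = 1 - S ^+ 2 by lra.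
by field.
Qed.

Lemma trigpoly_qarc b : trigpoly (qarc b).
Proof.
by do !(exact: trigpoly_cas || apply: trigpolyZ || apply: trigpolyD).
Qed.

Lemma qarc_le1 b x : `|qarc b x| <= 1.
Proof. by rewrite qarcE normrM mulr_ile1// sin_max. Qed.

Lemma sg_qarc (b x : R) : 0 < b < 1 -> 0 < x < 1 -> x != b ->
  1 + Num.sg (qarc b x) = 2 * (x <= b)%R%:R.
Proof.
move=> /andP[b0 b1] /andP[x0 x1] xb; have p0 := pi_gt0 R.
have sx : 0 < sin (pi * x) by apply: sin_gt0_pi; nra.
rewrite qarcE sgrM (gtr0_sg sx) mul1r.
have [xb'|xb'|/eqP] := ltgtP x b; last by rewrite (negbTE xb).
  by rewrite gtr0_sg/=; [ring|apply: sin_gt0_pi; nra].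
rewrite -opprB mulrN sinN sgrN gtr0_sg/=; first ring.
by apply: sin_gt0_pi; nra.
Qed.

Lemma trigpoly_bounded p : trigpoly p ->
  measurable_fun setT p /\ exists M, forall x : R, `|p x| <= M.
Proof.
elim=> [k|{}p q _ [mp [M pM]] _ [mq [N qN]]|a {}p _ [mp [M pM]]].
- by split; [exact: measurable_cas|exists 2 => x; exact: cas_le2].
- split; first exact: measurable_funD.
  by exists (M + N) => x; apply: le_trans (ler_normD _ _) _; exact: lerD.
- split; first exact: measurable_funM.
  by exists (`|a| * M) => x; rewrite normrM ler_wpM2l.
Qed.

Lemma trigpoly_sgnit n p : trigpoly p -> trigpoly (fun x : R => sgnit n (p x)).
Proof.
move=> tp; elim: n => // n ih.
rewrite (_ : (fun x => _) = (fun x => 3 / 2 * sgnit n (p x) +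
   (- 2^-1) * (sgnit n (p x) * (sgnit n (p x) * sgnit n (p x))))).
  apply: trigpolyD; apply: trigpolyZ => //.
  by apply: trigpolyM => //; exact: trigpolyM.
by apply/funext => x; rewrite sgnitS; field.
Qed.

Lemma cas_total1 (g : R -> R) :
  lambda.-integrable setT (EFin \o g) ->
  (forall k, (\int[lambda]_x (g x * cas k x) = 0)%R) ->
  {ae lambda, forall x, g x = 0}.
Proof.
move=> gi gk.
have mg : measurable_fun setT g by exact: integrable_measurable gi.
have tp p : trigpoly p -> (\int[lambda]_x (g x * p x) = 0)%R.
  elim=> [k|{}p q tp ih tq ihq|a {}p tp ih]; first exact: gk.
  - have [mp [M pM]] := trigpoly_bounded tp; have [mq [N qN]] :=
      trigpoly_bounded tq.
    under eq_Rintegral do rewrite mulrDr.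
    rewrite RintegralD//; first by rewrite ih ihq addr0.
    + exact: integrableM_bounded gi mp pM.
    + exact: integrableM_bounded gi mq qN.
  - have [mp [M pM]] := trigpoly_bounded tp.
    under eq_Rintegral do rewrite mulrCA.
    rewrite RintegralZl//; first by rewrite ih mulr0.
    exact: integrableM_bounded gi mp pM.
have msg b : measurable_fun setT (fun x : R => Num.sg (qarc b x)).
  apply: (@measurable_fun_cvg _ _ _ _ (fun n x => sgnit n (qarc b x))) =>
    [n|x _].
    by have [] := trigpoly_bounded (trigpoly_sgnit n (trigpoly_qarc b)).
  exact: sgnit_cvg (qarc_le1 b x).
have sg0 b : (\int[lambda]_x (g x * (1 + Num.sg (qarc b x))) = 0)%R.
  under eq_Rintegral do rewrite mulrDr mulr1.
  rewrite RintegralD//; last first.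
    apply: (@integrableM_bounded _ _ _ _ _ _ 1) => //.
      exact: msg.
    by move=> x; rewrite normr_sg; case: (_ != 0).
  rewrite (_ : \int[lambda]_x (g x * _) = 0) ?addr0.
    have := gk 0; by under eq_Rintegral do rewrite cas0 mulr1.
  apply: (@dominated_cvg0_Rintegral _ _ R lambda g
    (fun n x => sgnit n (qarc b x)) (fun x => Num.sg (qarc b x)) 1) => //.
  - by move=> n; have [] := trigpoly_bounded (trigpoly_sgnit n (trigpoly_qarc
      b)).
  - by move=> n x; apply: sgnit_le1; exact: qarc_le1.
  - by move=> x; apply: sgnit_cvg; exact: qarc_le1.
  - by move=> n; apply: tp; exact/trigpoly_sgnit/trigpoly_qarc.
pose I01 : set R := `]0, 1[%classic.
(* Extended by 0 to the whole line, the function can be integrated from minus infinity, as the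
   differentiation theorem below requires. *)
pose G x : R := if x \in I01 then g x else 0.
have gleb : leb.-integrable `[0%R, 1%R] (EFin \o g).
  by apply/integrable_mrestr => //; apply/measurable_EFinP.
have gleb' : leb.-integrable I01 (EFin \o g).
  apply: integrableS gleb => //; first exact: measurable_itv.
  by move=> x; rewrite /I01 /= !in_itv/= => /andP[/ltW-> /ltW->].
have Gi : leb.-integrable setT (EFin \o G).
  by apply: integrable_if => //; exact: measurable_itv.
have Gloc : locally_integrable setT G.
  have := integrable_locally measurableT Gi; rewrite (_ : G \_ setT = G)//.
  by apply/funext => x; rewrite patchE in_setT.
have mem3 (x : R) : x \in I01 = (0 < x < 1).
  by rewrite /I01 mem_setE in_itv.
(* On (0, 1), h is twice the indicator of x <= b except perhaps at b; the points 0, b and 1 form a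
   null set. *)
have key b (h : R -> R) : measurable_fun setT h ->
    (\int[lambda]_x (g x * h x) = 0)%R ->
    (forall x, 0 < x < 1 -> x != b -> h x = 2 * (x <= b)%R%:R) ->
    (\int[leb]_(x in `]-oo, b]) G x = 0)%R.
  move=> mh gh hE.
  have mgh : measurable_fun setT (fun x => g x * h x).
    exact: measurable_funM.
  have Gb : leb.-integrable setT (EFin \o (fun x => if x \in `]-oo,
    b]%classic then G x else 0)).
    by apply: integrable_if => //; exact: integrableS Gi.
  suff : 2 * (\int[leb]_x (if x \in `]-oo, b]%classic then G x else 0))%R = 0.
    move/eqP; rewrite mulf_eq0 pnatr_eq0 /= => /eqP H.
    by rewrite Rintegral_if.
  rewrite -RintegralZl// -[RHS]gh.
  have -> : \int[lambda]_x (g x * h x) = \int[leb]_(x in `[0%R,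
    1%R]) (g x * h x).
    rewrite /Rintegral; congr fine; apply: integral_mrestr.
    exact/measurable_EFinP.
  rewrite [RHS]Rintegral_if /Rintegral; congr fine.
  apply: ae_eq_integral => //.
  - by apply/measurable_EFinP; apply: measurable_funM => //;
      apply/measurable_EFinP; exact: measurable_int Gb.
  - by apply/measurable_EFinP; apply: measurable_fun_if0 => //;
      exact: measurable_itv.
  exists [set 0; b; 1]; split.
  - by do 2 apply: measurableU => //.
  - apply: countable_lebesgue_measure0; exact: finite_set_countable.
  move=> x /= /not_implyP[_]; apply: contra_notP.
  move=> /not_orP[/not_orP[/eqP x0 /eqP xb] /eqP x1].
  rewrite /G mem3 !mem_setE !in_itv/=.
  have [x01|x01] := boolP (0 < x < 1).
    have -> : 0 <= x <= 1 by case/andP: x01 => /ltW-> /ltW->.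
    rewrite (hE x)// => {hE}; case: ifP => _; rewrite ?mulr0// mulr1;
      congr EFin; ring.
  rewrite if_same mulr0; case: ifPn => // /andP[];
    rewrite !le_eqVlt eq_sym (negbTE x0) (negbTE x1)/= => h1 h2.
  by rewrite h1 h2 in x01.
(* For b outside (0, 1) the indicator is constant on (0, 1), so h is the constant 0 or 2; otherwise
   h is 1 plus the sign of [qarc b]. *)
have F0 b : (\int[leb]_(x in `]-oo, b]) G x = 0)%R.
  have [b0|b0] := leP b 0.
    apply: (key b (cst 0)) => //=.
      by under eq_Rintegral do rewrite mulr0; rewrite Rintegral_cst// mul0r.
    by move=> x /andP[x0 _] _; rewrite leNgt (le_lt_trans b0 x0) /= mulr0.
  have [b1|b1] := leP 1 b.
    apply: (key b (cst 2)) => //=.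
      rewrite RintegralZr//; have := gk 0; under eq_Rintegral do rewrite cas0
        mulr1.
      by move=> ->; rewrite mul0r.
    by move=> x /andP[_ x1] _; rewrite (ltW (lt_le_trans x1 b1)) mulr1.
  apply: (key b _ _ (sg0 b)); first by apply: measurable_funD.
  by move=> x x01 xb; apply: sg_qarc => //; rewrite b0.
(* Lebesgue differentiation: almost everywhere G is the derivative of its primitive, which is
   identically 0. *)
have [|N [mN N0 sN]] := @FTC1Ny R G _ Gloc.
  by move=> y; apply: integrableS Gi.
have mI : measurable (~` I01) by apply: measurableC; exact: measurable_itv.
have e01 : (leb [set 0%R; 1%R] = 0)%E.
  by apply: countable_lebesgue_measure0; exact: finite_set_countable.
have m01 : measurable [set (0:R); 1] by exact: measurableU.
(* Of the complement of (0, 1), the restricted measure sees only the two endpoints. *)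
exists (N `|` ~` I01); split.
- exact: measurableU.
- apply/eqP; rewrite eq_le measure_ge0 andbT.
  apply: (@le_trans _ _ (leb (N `|` [set 0; 1]))).
    apply: le_measure; rewrite ?inE.
    + by apply: measurableI; [exact: measurableU|exact: measurable_itv].
    + exact: measurableU.
    move=> x [[Nx|/= nx]]; first by left.
    rewrite /= in_itv/= => /andP[x0 x1]; right => /=.
    move: nx x0 x1; rewrite /I01 /= in_itv/= !le_eqVlt => nx.
    by move=> /predU1P[->|x0]; [left|move=> /predU1P[->|x1]; [right|exfalso;
      apply: nx; rewrite x0 x1]].
  apply: (le_trans (measureU2 _ _ _)) => //.
  have h1 : (leb N <= 0)%E by rewrite le_eqVlt; apply/orP; left; apply/eqP.
  have h2 : (leb [set 0%R; 1%R] <= 0)%E by rewrite le_eqVlt; apply/orP; left;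
    apply/eqP.
  by rewrite -[leRHS]adde0; exact: leeD.
move=> x /= gx; have [x01|x01] := boolP (0 < x < 1); [left|right]; last first.
  by rewrite /I01/= in_itv/=; exact/negP.
apply: sN => /= -[_]; rewrite (_ : (fun _ => _) = cst 0); last exact/funext.
by rewrite derive1_cst /G mem3 x01 => /esym.
Qed.
End totality1.

(** * Total families on products *)

(** Totality is stated in L^1, the class that Fubini preserves: almost all slices and all partial
    coefficients of an integrable function are integrable. *)
Definition total_family d (T : measurableType d) (R : realType)
    (mu : {measure set T -> \bar R}) (K : Type) (c : K -> T -> R) :=
  forall g : T -> R, mu.-integrable setT (EFin \o g) ->
    (forall k, (\int[mu]_x (g x * c k x) = 0)%R) -> {ae mu, forall x, g x = 0}.

Lemma ae_forall_count d (T : measurableType d) (R : realType)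
    (mu : {measure set T -> \bar R}) (K : countType) (Q : K -> T -> Prop) :
  (forall k, {ae mu, forall x, Q k x}) -> {ae mu, forall x, forall k, Q k x}.
Proof.
move=> h.
have : {ae mu, forall x, forall n, if unpickle n is Some k then Q k x else
  True}.
  by apply/ae_foralln => n; case: (unpickle n) => [k|]; [exact: h|exact: aeW].
by apply: filterS => x H k; have := H (pickle k); rewrite pickleK.
Qed.

Section product_total.
Context d1 d2 (T1 : measurableType d1) (T2 : measurableType d2) (R : realType).
Variables (m1 : probability T1 R) (m2 : probability T2 R).
Variables (K : countType) (J : Type) (c : K -> T1 -> R) (e : J -> T2 -> R).
Hypotheses (mc : forall k, measurable_fun setT (c k))
  (me : forall j, measurable_fun setT (e j)).
Hypotheses (bc : forall k, exists M : R, forall x, `|c k x| <= M)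
  (be : forall j, exists M : R, forall x, `|e j x| <= M).

(** The coefficient of f along [c k] in the first variable is a function of y whose coefficients
    along [e] are those of f, so it vanishes for almost all y. As [K] is countable, one null set of
    y serves all k; for the other y, the slice of f vanishes by totality of [c]. *)
Lemma product_total : total_family m1 c -> total_family m2 e ->
  total_family (m1 \x m2)%E
    (fun kj : K * J => fun z : T1 * T2 => c kj.1 z.1 * e kj.2 z.2).
Proof.
move=> tc te f fi f0.
have mf : measurable_fun setT f by exact: integrable_measurable fi.
pose fk k (z : T1 * T2) := f z * c k z.1.
have mc1 k : measurable_fun setT (fun z : T1 * T2 => c k z.1).
  exact: measurableT_comp.
have me2 j : measurable_fun setT (fun z : T1 * T2 => e j z.2).
  exact: measurableT_comp.
have fki k : (m1 \x m2)%E.-integrable setT (EFin \o fk k).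
  by have [M cM] := bc k; apply: integrableM_bounded fi (mc1 k) (fun z =>
    cM z.1).
pose h k y := (\int[m1]_x fk k (x, y))%R.
have hi k : m2.-integrable setT (EFin \o h k).
  have mG := measurable_fubini_G (fki k).
  apply/integrableP; split.
    by apply/measurable_EFinP; apply: measurableT_comp mG.
  have mfk := measurable_int _ (fki k).
  apply: le_lt_trans ((integrable21ltyP _ _ mfk).1 (fki k)).
  apply: ge0_le_integral => //.
  - by apply: measurableT_comp => //; apply/measurable_EFinP;
      apply: measurableT_comp mG.
  - apply: (measurable_fun_fubini_tonelli_G (abse \o (EFin \o fk k))).
      exact: measurableT_comp.
    by move=> z; exact: abse_ge0.
  (* Only an inequality: where the inner integral is infinite, the real-valued [h k y] is 0. *)
  move=> y _; apply: (@le_trans _ _ `|fubini_G m1 (EFin \o fk k) y|%E).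
    rewrite /=; have -> : h k y = fine (fubini_G m1 (EFin \o fk k) y) by [].
    by case: (fubini_G _ _ _) => [r| |] //=; rewrite ?normr0 ?leey.
  apply: le_abse_integral => //.
  exact: measurableT_comp mfk (pair2_measurable _).
have h0 k : {ae m2, forall y, h k y = 0}.
  apply: te (hi k) _ => j; have [M eM] := be j.
  have fkei := integrableM_bounded (fki k) (me2 j) (fun z => eM z.2).
  transitivity (\int[(m1 \x m2)%E]_z (fk k z * e j z.2)); last first.
    rewrite -[RHS](f0 (k, j)); apply: eq_Rintegral => z _ /=.
    by rewrite /fk mulrA.
  rewrite /Rintegral; congr fine; rewrite -(integral21_prod_meas1 fkei).
  apply: ae_eq_integral => //.
  - apply/measurable_EFinP; apply: measurable_funM => //.
    by apply/measurable_EFinP; exact: measurable_int (hi k).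
  - exact: (measurable_fubini_G fkei).
  have := ae_integrable2 (fki k); apply: filterS => y iy _.
  rewrite /fubini_G /= EFinM /h /Rintegral fineK;
    last exact: integrable_fin_num iy.
  by rewrite -integralZr.
have fy0 : {ae m2, forall y, (\int[m1]_x `|(f (x, y))%:E| = 0)%E}.
  have H1 := ae_integrable2 fi.
  have H2 := ae_forall_count h0.
  apply: filterS2 H1 H2 => y iy hy.
  have := tc _ iy hy => aey.
  apply/(@ae_eq_integral_abs _ _ _ m1 setT) => //.
    exact: measurable_int iy.
  by apply: filterS aey => x /= -> _.
have : ae_eq (m1 \x m2)%E setT (EFin \o f) (cst 0%E).
  apply/ae_eq_integral_abs => //; first exact/measurable_EFinP.
  have mabs : measurable_fun setT (abse \o (EFin \o f)).
    by apply: measurableT_comp => //; exact/measurable_EFinP.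
  rewrite -[LHS]/(\int[m1 \x m2]_z (abse \o (EFin \o f)) z)%E fubini_tonelli2//.
    rewrite -(@integral0 _ _ _ m2 setT); apply: ae_eq_integral => //.
      apply: (measurable_fun_fubini_tonelli_G (abse \o (EFin \o f))) => //.
      by move=> z; exact: abse_ge0.
    by apply: filterS fy0 => y fy _.
  by move=> z; exact: abse_ge0.
move=> [N [mN N0 sN]]; exists N; split => // z /= fz; apply: sN => /=.
by move=> /(_ I)[].
Qed.
End product_total.

(** * Fourier analysis on the torus *)

(** In integral form, vanishing almost everywhere can be moved across the image measure that defines
    [torus_measure]. *)
Lemma ae0_integralP d (T : measurableType d) (R : realType)
    (mu : {measure set T -> \bar R}) (f : T -> R) : measurable_fun setT f ->
  {ae mu, forall x, f x = 0} <-> (\int[mu]_x `|f x|%:E = 0)%E.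
Proof.
move=> mf.
have := @ae_eq_integral_abs _ _ _ mu setT measurableT (EFin \o f).
case; first exact/measurable_EFinP.
move=> h1 h2; split=> [[N [mN N0 sN]]|/h1 [N [mN N0 sN]]].
  apply: h2; exists N; split => // x /= fx; apply: sN => /= fx0; apply: fx.
  by rewrite fx0.
by exists N; split => // x /= fx; apply: sN => /= /(_ I) [].
Qed.

Lemma Rintegral_product d1 d2 (T1 : measurableType d1) (T2 : measurableType d2)
  (R : realType) (m1 : probability T1 R) (m2 : probability T2 R)
  (u : T1 -> R) (v : T2 -> R) (M N : R) :
  measurable_fun setT u -> measurable_fun setT v ->
  (forall x, `|u x| <= M) -> (forall y, `|v y| <= N) ->
  \int[(m1 \x m2)%E]_z (u z.1 * v z.2) =
  (\int[m1]_x u x) * (\int[m2]_y v y).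
Proof.
move=> mu mv uM vN.
have c1 (d : measure_display) (T : measurableType d) (m : probability T R) :
    m.-integrable setT (EFin \o cst 1).
  exact: finite_measure_integrable_cst.
have ui : m1.-integrable setT (EFin \o u).
  have := integrableM_bounded (c1 _ _ m1) mu uM.
  by apply: eq_integrable => // x _ /=; rewrite mul1r.
have vi : m2.-integrable setT (EFin \o v).
  have := integrableM_bounded (c1 _ _ m2) mv vN.
  by apply: eq_integrable => // x _ /=; rewrite mul1r.
have uvi : (m1 \x m2)%E.-integrable setT (EFin \o (fun z => u z.1 * v z.2)).
  have mu1 : measurable_fun setT (fun z : T1 * T2 =>
    u z.1) by exact: measurableT_comp.
  have mv2 : measurable_fun setT (fun z : T1 * T2 =>
    v z.2) by exact: measurableT_comp.
  have h := integrableM_bounded (c1 _ _ (m1 \x m2)%E) mu1 (fun z => uM z.1).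
  have := integrableM_bounded h mv2 (fun z => vN z.2).
  by apply: eq_integrable => // x _ /=; rewrite mul1r.
rewrite -RintegralZl// /Rintegral; congr fine.
rewrite -(integral21_prod_meas1 uvi); apply: eq_integral => y _.
rewrite /fubini_G /= EFinM -[LHS]/(\int[m1]_x (u x * v y)%:E)%E.
under eq_integral do rewrite EFinM.
by rewrite integralZr// fineK//; exact: integrable_fin_num ui.
Qed.

Section torus_fourier.
Context (R : realType).
Local Notation lambda := (@unit_lebesgue R).

Lemma measurable_coord n (i : 'I_n) :
  measurable_fun setT (fun x : 'rV[R]_n => x ord0 i).
Proof.
by have /measurable_fun_rowP := @measurable_id _ 'rV[R]_n setT.
Qed.

Lemma row_cons0 n x (y : 'rV[R]_n) : row_cons (x, y) ord0 ord0 = x.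
Proof.
by rewrite /row_cons mxE; case: splitP => // j _; rewrite mxE.
Qed.

Lemma row_consS n x (y : 'rV[R]_n) i : row_cons (x,
  y) ord0 (lift ord0 i) = y ord0 i.
Proof.
rewrite /row_cons mxE; case: splitP => [j|j] /=; first by rewrite ord1.
by move=> /eqP; rewrite /bump /= !add1n eqSS => /eqP /val_inj ->.
Qed.

Lemma integrable_torusS n (f : 'rV[R]_n.+1 -> R) :
  (torus_measure n.+1).-integrable setT (EFin \o f) ->
  (lambda \x torus_measure n)%E.-integrable setT (EFin \o (f \o @row_cons R n)).
Proof.
move=> fi; have mf : measurable_fun setT f by exact: integrable_measurable fi.
apply/integrableP; split.
  by apply/measurable_EFinP; apply: measurableT_comp.
have /integrableP[_] := fi; apply: le_lt_trans.
rewrite /= ge0_integral_distribution//.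
by apply/measurable_EFinP; exact: measurableT_comp.
Qed.

Lemma Rintegral_torusS n (f : 'rV[R]_n.+1 -> R) :
  (torus_measure n.+1).-integrable setT (EFin \o f) ->
  \int[torus_measure n.+1]_x f x =
  \int[(lambda \x torus_measure n)%E]_z f (row_cons z).
Proof.
move=> fi; have mf : measurable_fun setT f by exact: integrable_measurable fi.
rewrite /Rintegral; congr fine; rewrite /= integral_distribution//.
  exact/measurable_EFinP.
exact: integrable_torusS.
Qed.

(** Frequencies are finite functions to have decidable equality, needed for sums over duplicate-free
    lists. *)
Definition tcas d (k : {ffun 'I_d -> int}) (x : 'rV[R]_d) : R :=
  \prod_(i < d) cas (k i) (x ord0 i).

Lemma measurable_prod_coord d (h : 'I_d -> R -> R) :
  (forall i, measurable_fun setT (h i)) ->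
  measurable_fun setT (fun x : 'rV[R]_d => \prod_(i < d) h i (x ord0 i)).
Proof.
move=> mh; apply: measurable_prod => i _.
by apply: measurableT_comp => //; exact: measurable_coord.
Qed.

Lemma prod_coord_bounded d (h : 'I_d -> R -> R) (M : R) :
  (forall i t, `|h i t| <= M) ->
  forall x : 'rV[R]_d, `|\prod_(i < d) h i (x ord0 i)| <= M ^+ d.
Proof.
move=> hM x; rewrite normr_prod; apply: (@le_trans _ _ (\prod_(i < d) M)).
  by apply: ler_prod => i _; rewrite normr_ge0 hM.
by rewrite big_const_ord iter_mulr_1.
Qed.

Lemma integrable_bounded d (T : measurableType d) (P : probability T R)
    (f : T -> R) (M : R) : measurable_fun setT f -> (forall x, `|f x| <= M) ->
  P.-integrable setT (EFin \o f).
Proof.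
move=> mf fM.
have c1 : P.-integrable setT (EFin \o cst 1) by exact:
  finite_measure_integrable_cst.
have := integrableM_bounded c1 mf fM.
by apply: eq_integrable => // x _ /=; rewrite mul1r.
Qed.

Lemma Rintegral_prod_coord d (h : 'I_d -> R -> R) (M : R) :
  (forall i, measurable_fun setT (h i)) -> (forall i t, `|h i t| <= M) ->
  \int[torus_measure d]_x (\prod_(i < d) h i (x ord0 i)) =
  \prod_(i < d) \int[lambda]_t h i t.
Proof.
elim: d h => [|n ih] h mh hM.
  rewrite big_ord0; under eq_Rintegral do rewrite big_ord0.
  by rewrite /Rintegral /= integral_dirac// diracT mul1e.
rewrite Rintegral_torusS; last first.
  exact: integrable_bounded (measurable_prod_coord mh) (prod_coord_bounded hM).
rewrite big_ord_recl -(ih (fun i => h (lift ord0 i)))//.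
have E := @Rintegral_product _ _ _ _ _ lambda (torus_measure n) (h ord0)
  (fun y : 'rV[R]_n => \prod_(i < n) h (lift ord0 i) (y ord0 i)) M (M ^+ n) (mh
    ord0)
  (measurable_prod_coord (fun i => mh (lift ord0 i))) (hM ord0)
  (prod_coord_bounded (fun i => hM (lift ord0 i))).
rewrite -[RHS]E; apply: eq_Rintegral => -[x y] _ /=.
rewrite big_ord_recl row_cons0; congr (_ * _).
by apply: eq_bigr => i _; rewrite row_consS.
Qed.

Lemma measurable_tcas d (k : {ffun 'I_d -> int}) : measurable_fun setT (tcas k).
Proof. exact: (measurable_prod_coord (fun i => @measurable_cas R (k i))). Qed.

Lemma tcas_bounded d (k : {ffun 'I_d -> int}) x : `|tcas k x| <= 2 ^+ d.
Proof.
by apply: (prod_coord_bounded (h := fun i => cas (k i))) => i t; exact: cas_le2.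
Qed.

Lemma tcas_total d : total_family (torus_measure d) (@tcas d).
Proof.
elim: d => [|n ih] f fi f0.
  have mf : measurable_fun setT f by exact: integrable_measurable fi.
  have [_ H] := @ae0_integralP _ _ R (torus_measure 0) f mf; apply: H.
  rewrite /= integral_dirac//; last first.
    by apply/measurable_EFinP; exact: measurableT_comp.
  (* In dimension 0 the measure is a point mass and [tcas] is the empty product 1. *)
  have := f0 [ffun=> 0]; rewrite /Rintegral /= integral_dirac//; last first.
    by apply/measurable_EFinP; apply: measurable_funM => //;
      exact: measurable_tcas.
  by rewrite diracT !mul1e /= /tcas big_ord0 mulr1 => ->; rewrite normr0.
have mf : measurable_fun setT f by exact: integrable_measurable fi.
have [_ H0] := @ae0_integralP _ _ R (torus_measure n.+1) f mf; apply: H0 => /=;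
  rewrite ge0_integral_distribution//=; last first.
  by apply/measurable_EFinP; exact: measurableT_comp.
have bc (k : int) : exists M : R, forall x : R, `|cas k x| <= M.
  by exists 2 => x; exact: cas_le2.
have bt (k : {ffun 'I_n -> int}) : exists M : R, forall x : 'rV[R]_n,
  `|tcas k x| <= M.
  by exists (2 ^+ n) => x; exact: tcas_bounded.
have := @product_total _ _ _ _ _ lambda (torus_measure n) int _ (@cas R) (@tcas
  n).
move=> /(_ (@measurable_cas R)).
move=> /(_ (@measurable_tcas n)) /(_ bc).
move=> /(_ bt) /(_ (@cas_total1 R) ih).
move=> /(_ _ (integrable_torusS fi)) H.
have [H1 _] := @ae0_integralP _ _ R (lambda \x torus_measure n)%E (f \o
  @row_cons R n)
  (measurableT_comp mf (@measurable_row_cons R n)).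
apply: H1.
apply: H => -[k k'] /=.
pose kk : {ffun 'I_n.+1 -> int} := [ffun i : 'I_n.+1 =>
  if unlift ord0 i is Some j then k' j else k].
rewrite -[RHS](f0 kk) Rintegral_torusS.
  apply: eq_Rintegral => -[x y] _ /=; congr (_ * _).
  rewrite /tcas big_ord_recl row_cons0 ffunE unlift_none; congr (_ * _).
  by apply: eq_bigr => i _; rewrite row_consS ffunE liftK.
exact: integrableM_bounded fi (measurable_tcas kk) (tcas_bounded kk).
Qed.

End torus_fourier.

(** * Orthonormality, periodicity and smoothness of the trigonometric family *)

Section tcas_orthonormality.
Context (R : realType).
Local Notation lambda := (@unit_lebesgue R).

Lemma Rintegral_cas (k : int) : \int[lambda]_x (cas k x) = (k == 0)%:R :> R.
Proof.
have [->|k0] := eqVneq k 0.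
  under eq_Rintegral do rewrite cas0.
  by rewrite Rintegral_cst// mul1r -[RHS]/(fine 1%E); congr fine;
    exact: unit_lebesgue_setT.
have c0 : 2 * pi * (- k)%:~R != 0 :> R.
  by rewrite !mulf_eq0 !negb_or pnatr_eq0 intr_eq0 oppr_eq0 k0 andbT /= gt_eqF
    ?pi_gt0.
(* A primitive of [cas k], with equal values at 0 and 1 by periodicity. *)
pose F (x : R) := (2 * pi * (- k)%:~R)^-1 * cas (- k) x.
have dF x : is_derive (x : R) 1 F (cas k x).
  have h := is_derive_cas (- k) x; rewrite opprK in h.
  by apply: is_derive_eq; rewrite /GRing.scale/= mulKf.
have cF : continuous F.
  by move=> x; apply/differentiable_continuous/derivable1_diffP; case: (dF x).
rewrite /Rintegral integral_mrestr; last first.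
  by apply/measurable_EFinP; exact: measurable_cas.
rewrite (@continuous_FTC2 _ _ F)//.
- by rewrite -EFinB /= /F -[cas (- k) 1](congr1 (cas (- k)) (add0r (1:R)))
    casD1 subrr.
- by apply: continuous_subspaceT => x; exact: continuous_cas.
- split => [x _||].
  + by case: (dF x).
  + by apply: cvg_at_right_filter; exact: cF.
  + by apply: cvg_at_left_filter; exact: cF.
- by move=> x _; rewrite derive1E; apply: derive_val.
Qed.

Lemma Rintegral_casM (k l : int) :
  \int[lambda]_x (cas k x * cas l x) = (k == l)%:R :> R.
Proof.
have ci m : lambda.-integrable setT (EFin \o (fun x : R => cas m x)).
  exact: (@integrable_bounded _ _ _ lambda (cas m) 2 (measurable_cas m)
    (cas_le2 m)).
have ciZ (a : R) m : lambda.-integrable setT (EFin \o (fun x : R =>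
  a * cas m x)).
  by have := integrableZl measurableT a (ci m).
transitivity (\int[lambda]_x ((2^-1 * cas (k - l) x + 2^-1 * cas (l - k) x) +
     (2^-1 * cas (k + l) x + (- 2^-1) * cas (- (k + l)) x)))%R.
  by apply: eq_Rintegral => x _; rewrite casM; field.
have ciD (a b : R) m n : lambda.-integrable setT
    (EFin \o (fun x : R => a * cas m x + b * cas n x)).
  by have := integrableD measurableT (ciZ a m) (ciZ b n).
rewrite RintegralD// RintegralD// RintegralD// !RintegralZl// !Rintegral_cas.
(* The two terms at k + l and - (k + l) have equal integrals and cancel. *)
rewrite oppr_eq0 !subr_eq0 (eq_sym l k).
move: ((k == l)%:R : R) ((k + l == 0)%:R : R) => a b; by field.
Qed.

Lemma tcas_orthonormal d (k l : {ffun 'I_d -> int}) :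
  \int[torus_measure d]_x (tcas k x * tcas l x) = (k == l)%:R :> R.
Proof.
under eq_Rintegral do rewrite /tcas -big_split /=.
rewrite (@Rintegral_prod_coord R d (fun i x => cas (k i) x * cas (l i) x) 4).
- under eq_bigr do rewrite Rintegral_casM.
  have [->|kl] := eqVneq k l; first by rewrite big1// => i _; rewrite eqxx.
  have [i kli] : exists i, k i != l i.
    by apply/existsP; apply: contraNT kl; rewrite negb_exists => /forallP h;
      apply/eqP/ffunP => i; apply/eqP; have := h i; rewrite negbK.
  by rewrite (bigD1 i)//= (negbTE kli) mul0r.
- by move=> i; apply: measurable_funM; exact: measurable_cas.
- move=> i t; rewrite normrM (_ : 4 = 2 * 2 :> R); last ring.
  by apply: ler_pM => //; exact: cas_le2.
Qed.

(** The effect on frequencies of differentiating in direction j, since cos - sin is [cas] at the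
    opposite argument. *)
Definition negate_freq d (j : 'I_d) (k : {ffun 'I_d -> int}) : {ffun 'I_d ->
  int} :=
  [ffun i => if i == j then - k i else k i].

Lemma negate_freqK d (j : 'I_d) : involutive (negate_freq j).
Proof. by move=> k; apply/ffunP => i; rewrite !ffunE; case: eqP;
  rewrite ?opprK. Qed.

Lemma basis_ptE d (j i : 'I_d) : basis_pt R j ord0 i = (i == j)%:R.
Proof. by rewrite /basis_pt mxE eqxx eq_sym. Qed.

Lemma tcas_line d (k : {ffun 'I_d -> int}) j (x : 'rV[R]_d) h :
  tcas k (h *: basis_pt R j + x) =
  (\prod_(i < d | i != j) cas (k i) (x ord0 i)) * cas (k j) (h + x ord0 j).
Proof.
rewrite /tcas (bigD1 j)//= mulrC; congr (_ * _).
  apply: eq_bigr => i ij; rewrite 2!mxE basis_ptE (negbTE ij) mulr0 add0r//.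
by rewrite 2!mxE basis_ptE eqxx mulr1.
Qed.

Lemma one_periodic_tcas d (k : {ffun 'I_d -> int}) : one_periodic (@tcas R d k).
Proof.
move=> j x; rewrite addrC -[basis_pt R j]scale1r tcas_line addrC -[x in
  RHS]add0r.
by rewrite -(scale0r (basis_pt R j)) tcas_line casD1 add0r.
Qed.

Lemma is_derive_line d (f : 'rV[R]_d -> R) (x v : 'rV[R]_d) (g : R -> R) (t c l
  : R) :
  (forall h, f (h *: v + x) = c * g (h + t)) -> is_derive t 1 g l ->
  is_derive x v f (c * l).
Proof.
move=> fg [dg lE].
have fx : f x = c * g t by have := fg 0; rewrite scale0r !add0r.
have E : (fun h => h^-1 *: ((f \o shift x) (h *: v) - f x)) =
   (fun h => c * (h^-1 *: ((g \o shift t) (h *: (1:R)) - g t))).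
  apply/funext => h /=; rewrite fg fx -mulrBr /GRing.scale/= mulr1; ring.
have cv : h^-1 *: ((f \o shift x) (h *: v) - f x) @[h --> 0^'] --> c * l.
  rewrite E; apply: cvgMr; rewrite -lE; exact: dg.
split.
  by apply/cvg_ex; exists (c * l).
by apply/cvg_lim.
Qed.

Lemma is_derive_tcas d (k : {ffun 'I_d -> int}) j (x : 'rV[R]_d) :
  is_derive x (basis_pt R j) (tcas k) (2 * pi * (k j)%:~R * tcas (negate_freq j
    k) x).
Proof.
have -> : 2 * pi * (k j)%:~R * tcas (negate_freq j k) x =
   (\prod_(i < d | i != j) cas (k i) (x ord0 i)) *
   (2 * pi * (k j)%:~R * cas (- k j) (x ord0 j)).
  rewrite /tcas (bigD1 j)//= ffunE eqxx.
  rewrite (eq_bigr (fun i => cas (k i) (x ord0 i))); first ring.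
  by move=> i ij; rewrite ffunE (negbTE ij).
apply: is_derive_line; last exact: is_derive_cas.
by move=> h; rewrite tcas_line.
Qed.

Lemma partial_tcas d (k : {ffun 'I_d -> int}) j :
  partial j (tcas k) = fun x : 'rV[R]_d => 2 * pi * (k j)%:~R * tcas
    (negate_freq j k) x.
Proof. by apply/funext => x; rewrite /partial; have := is_derive_tcas k j x =>
  h; exact: derive_val. Qed.

Lemma continuous_tcas d (k : {ffun 'I_d -> int}) : continuous (@tcas R d k).
Proof.
apply: (@continuous_big R 'I_d *%R 1 xpredT (@mul_continuous R) _ _
  (fun i (x : 'rV[R]_d) => cas (k i) (x ord0 i))) => i _ x.
apply: (@continuous_comp _ _ _ (fun x : 'rV[R]_d => x ord0 i) (cas (k i))).
  exact: coord_continuous.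
exact: continuous_cas.
Qed.

Lemma CkZ d n a (f : 'rV[R]_d -> R) : Ck n f -> Ck n (fun x => a * f x).
Proof.
elim: n f => [|n ih] f /= [cf df]; split => //.
- by move=> x; apply: continuousM; [exact: cst_continuous|exact: cf].
- by move=> x; apply: continuousM; [exact: cst_continuous|exact: cf].
move=> i; have [dfi Cfi] := df i; split.
  by move=> x; have := @derivableZ _ _ _ f a x (basis_pt R i) (dfi x).
rewrite (_ : partial i _ = fun x => a * partial i f x); first exact: ih.
by apply/funext => x; have := @deriveZ _ _ _ f a x (basis_pt R i) (dfi x).
Qed.

Lemma smooth_tcas d (k : {ffun 'I_d -> int}) : smooth (@tcas R d k).
Proof.
move=> n; elim: n k => [|n ih] k /=; split => //.
- exact: continuous_tcas.
- exact: continuous_tcas.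
move=> i; split; first by move=> x; have [] := is_derive_tcas k i x.
by rewrite partial_tcas; exact: CkZ.
Qed.

End tcas_orthonormality.

(** * Measurability and boundedness of continuous periodic functions *)

Section continuous_row.
Context (R : realType) (d : nat).
Local Notation pt := 'rV[R]_d.

(* Rounding to a countable grid makes a continuous function measurable for the
   sigma-algebra generated by the coordinates. *)
Definition grid (n : nat) (z : {ffun 'I_d -> int}) : pt :=
  \row_i ((z i)%:~R / n.+1%:R).

Definition grid_index (n : nat) (x : pt) : {ffun 'I_d -> int} :=
  [ffun i => Num.floor (x ord0 i * n.+1%:R)].

Lemma grid_approx n (x : pt) i : `|x ord0 i - grid n (grid_index n x) ord0 i|
  <= n.+1%:R^-1.
Proof.
rewrite mxE ffunE.
have n0 : 0 < n.+1%:R :> R by rewrite ltr0n.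
have /andP[h1 h2] := floor_itv (x ord0 i * n.+1%:R); rewrite intrD in h2.
have -> : x ord0 i - (Num.floor (x ord0 i * n.+1%:R))%:~R / n.+1%:R =
  (x ord0 i * n.+1%:R - (Num.floor (x ord0 i * n.+1%:R))%:~R) / n.+1%:R.
  by rewrite mulrBl mulfK ?gt_eqF.
rewrite normrM [X in _ * X]ger0_norm ?invr_ge0 ?(ltW n0)//.
rewrite -[leRHS]mul1r ler_wpM2r ?invr_ge0 ?(ltW n0)//.
rewrite ger0_norm; lra.
Qed.

Lemma grid_approx_cvg (x : pt) : grid n (grid_index n x) @[n --> \oo] --> x.
Proof.
apply/cvgrPdist_le => /= e e0.
have [N _ HN] := @near_infty_natSinv_lt R (PosNum e0).
exists N => // n /= /HN /= h.
apply: le_trans (ltW h); rewrite [leLHS]mx_normrE.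
apply: bigmax_le => [|[i j] _]; first by rewrite invr_ge0.
by rewrite !mxE /= [i]ord1; have := grid_approx n x j; rewrite mxE.
Qed.

Lemma measurable_grid_index n z : measurable [set x : pt | grid_index n x = z].
Proof.
have n0 : 0 < n.+1%:R :> R by rewrite ltr0n.
rewrite (_ : [set _ | _] = \bigcap_(i in [set: 'I_d])
   (fun x : pt => x ord0 i) @^-1` `[(z i)%:~R / n.+1%:R,
     (z i + 1)%:~R / n.+1%:R[%classic).
  apply: fin_bigcap_measurable => // i _.
  rewrite -[X in measurable X]setTI.
  exact: measurable_coord.
apply/seteqP; split => [x /= <- i _|x h] /=.
  by rewrite ffunE in_itv/= ler_pdivrMr// ltr_pdivlMr// floor_itv.
apply/ffunP => i; rewrite ffunE; have := h i I.
by rewrite /= in_itv/= ler_pdivrMr// ltr_pdivlMr// => /floor_def.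
Qed.

Lemma continuous_measurable_row (f : pt -> R) : continuous f -> measurable_fun
  setT f.
Proof.
move=> cf; apply: (@measurable_fun_cvg _ _ _ _ (fun n x =>
  f (grid n (grid_index n x)))).
  move=> n _ B mB; rewrite setTI.
  (* The rounded function is constant on each of countably many cells. *)
  rewrite (_ : _ @^-1` B = \bigcup_z (if f (grid n z) \in B then [set x |
    grid_index n x = z] else set0)).
    apply: countable_bigcupT_measurable => // z.
    by case: ifP => _ //; exact: measurable_grid_index.
  apply/seteqP; split => [x /= Bx|x [z _]].
    by exists (grid_index n x) => //; rewrite mem_set.
  by case: ifPn => // /set_mem Bz /= zx; rewrite zx.
move=> x _; exact: (cvg_comp _ _ (grid_approx_cvg (x := x)) (cf x)).
Qed.

Lemma one_periodic_int (f : pt -> R) : one_periodic f ->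
  forall (r : seq 'I_d) (z : 'I_d -> int) x,
  f (x + \sum_(i <- r) (z i)%:~R *: basis_pt R i) = f x.
Proof.
move=> fp r z x.
have one i (y : pt) (k : int) : f (y + k%:~R *: basis_pt R i) = f y.
  case: k => n.
    by rewrite -pmulrn scaler_nat (periodicn (fp i)).
  rewrite NegzE mulrNz scaleNr -pmulrn scaler_nat.
  by rewrite -[in RHS](subrK (basis_pt R i *+ n.+1) y) (periodicn (fp i)).
elim: r x => [|i r ih] x; first by rewrite big_nil addr0.
by rewrite big_cons addrA ih one.
Qed.

(** Subtracting integer parts moves any point into the compact cube [0, 1]^d. *)
Lemma continuous_periodic_bounded (f : pt -> R) : continuous f -> one_periodic
  f ->
  exists M : R, forall x, `|f x| <= M.
Proof.
move=> cf fp.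
pose Q : set pt := [set v : pt | forall i, `[0%R, 1%R]%classic (v ord0 i)].
have cQ : compact Q by apply: (@rV_compact R d (fun=> `[0%R, 1%R]%classic)) =>
  i; exact: segment_compact.
have cfQ : compact (f @` Q) by apply: continuous_compact => //;
  exact: continuous_subspaceT.
have [M [_ HM]] := compact_bounded cfQ.
exists (M + 1) => x.
pose z := [ffun i => Num.floor (x ord0 i)].
rewrite -(one_periodic_int fp (index_enum 'I_d) (fun i => - z i) x).
apply: (HM (M + 1)); first by rewrite ltrDl.
set y := (X in f X).
have yE i : y ord0 i = x ord0 i - (z i)%:~R.
  rewrite /y mxE summxE (bigD1 i)//= big1 ?addr0 => [|j ji].
    by rewrite mxE basis_ptE eqxx mulr1 mulrNz.
  by rewrite mxE basis_ptE eq_sym (negbTE ji) mulr0.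
exists y => // i; rewrite /= yE in_itv/= ffunE.
have := floor_itv (x ord0 i); rewrite intrD => /andP[h1 h2]; apply/andP; split;
  lra.
Qed.

End continuous_row.

(** * The Poincare inequality *)

Section fourier_L2.
Context (R : realType) (d : nat).
Local Notation pt := 'rV[R]_d.
Local Notation mu := (@torus_measure R d).
Local Notation L2 := (Lfun mu 2%:E).
Local Notation K := {ffun 'I_d -> int}.
Local Notation ip := (@ip _ _ R mu).
Local Notation tc := (@tcas R d).

Lemma Lfun2_bounded (f : pt -> R) (M : R) : measurable_fun setT f ->
  (forall x, `|f x| <= M) -> f \in L2.
Proof.
move=> mf fM; apply/Lfun2P; split => //.
apply: (@integrable_bounded _ _ _ mu _ (M ^+ 2)); first exact: measurable_funX.
by move=> x; rewrite normrX lerXn2r ?nnegrE// (le_trans _ (fM x)).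
Qed.

Lemma tcas_Lfun2 k : tc k \in L2.
Proof. exact: Lfun2_bounded (measurable_tcas k) (tcas_bounded k). Qed.

Definition trigsum (S : seq K) (a : K -> R) : pt -> R :=
  \sum_(k <- S) a k *: tc k.

Lemma trigsum_Lfun2 S a : trigsum S a \in L2.
Proof.
rewrite /trigsum; elim: S => [|k S ih]; first by rewrite big_nil;
  exact: Lfun2_0.
by rewrite big_cons; apply: Lfun2_lin => //; exact: tcas_Lfun2.
Qed.

Lemma ip_trigsum u S a : u \in L2 ->
  ip (trigsum S a) u = \sum_(k <- S) a k * ip (tc k) u.
Proof.
move=> uL; have P := ip_psd_form mu.
rewrite /trigsum; elim: S => [|k S ih].
  by rewrite !big_nil; exact: (psd0l P uL).
rewrite !big_cons -ih (psdP P)//; first exact: tcas_Lfun2.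
exact: trigsum_Lfun2.
Qed.

Lemma ip_trigsum_tcas S a l : uniq S ->
  ip (trigsum S a) (tc l) = if l \in S then a l else 0.
Proof.
move=> uS; rewrite ip_trigsum; last exact: tcas_Lfun2.
have ipt k : ip (tc k) (tc l) = (k == l)%:R by exact: tcas_orthonormal.
have [lS|lS] := boolP (l \in S).
  rewrite (bigD1_seq l)//= ipt eqxx mulr1 big1 ?addr0// => k /negbTE kl.
  by rewrite ipt kl mulr0.
rewrite big1_seq// => k /= kS; rewrite ipt; case: eqP => [kl|];
  last by rewrite mulr0.
by rewrite -kl kS in lS.
Qed.

Lemma ip_trigsum_sqr S a : uniq S ->
  ip (trigsum S a) (trigsum S a) = \sum_(k <- S) a k ^+ 2.
Proof.
move=> uS; rewrite ip_trigsum; last exact: trigsum_Lfun2.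
apply: eq_big_seq => k kS; rewrite (psdC (ip_psd_form mu)); last 2 first.
- exact: tcas_Lfun2.
- exact: trigsum_Lfun2.
by rewrite ip_trigsum_tcas// kS expr2.
Qed.

(** The coefficients are arbitrary: Bessel's inequality takes those of u, while the Poincare
    inequality needs a lower bound valid for all a. *)
Lemma ip_sub_trigsum u S a : u \in L2 -> uniq S ->
  ip (u - trigsum S a) (u - trigsum S a) =
  ip u u - \sum_(k <- S) (2 * a k * ip u (tc k) - a k ^+ 2).
Proof.
move=> uL uS; have P := ip_psd_form mu; have tL := trigsum_Lfun2 S a.
rewrite addrC -scaleN1r (psd_sqr P)//= ip_trigsum_sqr// ip_trigsum//.
have -> : \sum_(k <- S) (2 * a k * ip u (tc k) - a k ^+ 2) =
    2 * \sum_(k <- S) a k * ip (tc k) u - \sum_(k <- S) a k ^+ 2.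
  rewrite sumrB mulr_sumr; congr (_ - _); apply: eq_bigr => k _.
  by rewrite (psdC P uL (tcas_Lfun2 k)) mulrA.
by ring.
Qed.

Lemma bessel u S : u \in L2 -> uniq S ->
  \sum_(k <- S) ip u (tc k) ^+ 2 <= ip u u.
Proof.
move=> uL uS.
have := psd_ge0 (ip_psd_form mu) (Lfun2B uL (trigsum_Lfun2 S (fun k =>
  ip u (tc k)))).
rewrite ip_sub_trigsum// subr_ge0; apply: le_trans.
by apply: ler_sum => k _; rewrite expr2; lra.
Qed.

Definition trigspan : set (pt -> R) :=
  [set p | exists S a, uniq S /\ p = trigsum S a].

Lemma trigsum_extend S S' a : uniq S -> uniq S' -> {subset S <= S'} ->
  trigsum S a = trigsum S' (fun k => if k \in S then a k else 0).
Proof.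
move=> uS uS' SS'; rewrite /trigsum.
rewrite [RHS](eq_bigr (fun k => if k \in S then a k *: tc k else 0));
  last first.
  by move=> k _; case: ifP => // _; rewrite scale0r.
rewrite -big_mkcond -big_filter; apply: perm_big; apply: uniq_perm => //.
  exact: filter_uniq.
by move=> k; rewrite mem_filter; case: (boolP (k \in S)) => // /SS' ->.
Qed.

Lemma trigspan_psd_form : psd_form trigspan ip.
Proof.
have P := ip_psd_form mu.
have sub p : trigspan p -> p \in L2 by case=> S [a [_ ->]];
  exact: trigsum_Lfun2.
split.
- by exists [::], (fun=> 0); split=> //; rewrite /trigsum big_nil.
- move=> c _ _ [S [a [uS ->]]] [S' [a' [uS' ->]]].
  have uU := undup_uniq (S ++ S').
  rewrite (trigsum_extend _ uS uU) => [|k kS];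
    last by rewrite mem_undup mem_cat kS.
  rewrite (trigsum_extend a' uS' uU) => [|k kS];
    last by rewrite mem_undup mem_cat kS orbT.
  exists (undup (S ++ S')), (fun k => c * (if k \in S then a k else 0) + (if k
    \in S' then a' k else 0)).
  split=> //; rewrite /trigsum scaler_sumr -big_split/=; apply: eq_bigr => k _.
  by rewrite scalerDl scalerA.
- by move=> p q /sub pL /sub qL; exact: (psdC P).
- by move=> a p q r /sub pL /sub qL /sub rL; exact: (psdP P).
- by move=> p /sub pL; exact: (psd_ge0 P).
Qed.

Lemma Lfun2_total u : u \in L2 -> (forall k, ip u (tc k) = 0) ->
  {ae mu, forall x, u x = 0}.
Proof. by move=> uL; exact: (tcas_total (integrable_Lfun2 uL)). Qed.

(** Apply [psd_riesz] on the span to the functional [ip u], bounded with C = ip u u. The L^2 limit w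
    of the resulting sequence has the same coefficients as u, so w = u almost everywhere by
    totality. *)
Lemma trigspan_dense u : u \in L2 ->
  exists p : nat -> pt -> R, (forall n, trigspan (p n)) /\
   ip (p n - u) (p n - u) @[n --> \oo] --> (0 : R).
Proof.
move=> uL; have P := ip_psd_form mu.
have sub p : trigspan p -> p \in L2 by case=> S [a [_ ->]];
  exact: trigsum_Lfun2.
have [p [Vp cp pcvg]] := psd_riesz trigspan_psd_form (psd_ge0 P uL)
  (f := ip u) (fun a x y xV yV => etrans (psdC P uL (Lfun2_lin a (sub _ xV)
    (sub _ yV)))
    (etrans (psdP P a (sub _ xV) (sub _ yV) uL) (congr2 +%R (congr1 ( *%R a)
      (psdC P (sub _ xV) uL)) (psdC P (sub _ yV) uL))))
  (fun x xV => psd_CauchySchwarz P uL (sub _ xV)).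
have pL n : p n \in L2 by exact: sub.
have [F [wL wcvg]] := Lfun2_complete pL cp.
set w : pt -> R := fun x => F _ in wL wcvg.
exists p; split => //.
have wu : {ae mu, forall x, (u - w) x = 0}.
  apply: Lfun2_total => [|k]; first exact: Lfun2B.
  have kV : trigspan (tc k).
    exists [:: k], (fun=> 1); split => //.
    by rewrite /trigsum big_seq1 scale1r.
  rewrite (psdBl P)//; last exact: tcas_Lfun2.
  apply/eqP; rewrite subr_eq0; apply/eqP.
  have h1 := pcvg _ kV.
  have h2 : ip (p n) (tc k) @[n --> \oo] --> ip w (tc k).
    exact: (ip_cvg pL wL (tcas_Lfun2 k) wcvg).
  exact: (cvg_unique _ h1 h2).
rewrite (_ : (fun n => _) = (fun n => ip (p n - w) (p n - w)))//.
apply/funext => n; apply: Rintegral_ae.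
- by apply: measurable_funM; apply: measurable_Lfun2; exact: Lfun2B.
- by apply: measurable_funM; apply: measurable_Lfun2; exact: Lfun2B.
by apply: filterS wu => x /eqP; rewrite subr_eq0 => /eqP ux; congr (_ * _);
  congr (_ - _).
Qed.

(* The constant is 1 because |2 pi k_j| >= 1 for k_j <> 0. *)
Lemma poincare (u : pt -> R) (G : pt -> 'cV[R]_d) : u \in L2 ->
  is_weak_gradient u G -> \int[mu]_x u x = 0 ->
  ip u u <= \sum_i ip (fun y => G y i ord0) (fun y => G y i ord0).
Proof.
move=> uL [_ GL uG] u0; have P := ip_psd_form mu.
set C := \sum_i _.
have hat (k : K) : ip u (tc k) ^+ 2 <=
    \sum_i ip (fun y => G y i ord0) (tc (negate_freq i k)) ^+ 2.
  have [->|k0] := eqVneq k 0.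
    rewrite (_ : ip _ _ = 0) ?expr0n/=; first by apply: sumr_ge0 => i _;
      exact: sqr_ge0.
    rewrite -[RHS]u0; apply: eq_Rintegral => x _.
    by rewrite /tcas big1 ?mulr1// => i _; rewrite ffunE cas0.
  have [j kj] : exists j, k j != 0.
    by apply/existsP; apply: contraNT k0; rewrite negb_exists => /forallP h;
      apply/eqP/ffunP => i; apply/eqP; have := h i; rewrite negbK ffunE.
  (* The test function whose j-th derivative is a multiple of [tcas k]. *)
  have := uG _ (smooth_tcas R (negate_freq j k)) (one_periodic_tcas
    (negate_freq j k)) j.
  rewrite partial_tcas negate_freqK ffunE eqxx.
  set c : R := 2 * pi * _.
  have -> : \int[mu]_y (u y * (c * tc k y)) = c * ip u (tc k).
    rewrite -RintegralZl//; last exact: integrable_Lfun2M uL (tcas_Lfun2 k).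
    by apply: eq_Rintegral => y _; rewrite mulrCA.
  rewrite -[X in _ = - X]/(ip (fun y => G y j ord0) (tc (negate_freq j k))) =>
    E.
  rewrite (bigD1 j)//= -[X in _ <= X + _]sqrrN -E exprMn.
  apply: (@le_trans _ _ (c ^+ 2 * ip u (tc k) ^+ 2)); last first.
    by rewrite lerDl sumr_ge0// => i _; exact: sqr_ge0.
  rewrite ler_peMl ?sqr_ge0// /c rmorphN/= mulrN sqrrN.
  have c1 : 1 <= `|2 * pi * (k j)%:~R| :> R.
    rewrite !normrM -[X in X <= _]mulr1 ler_pM//.
      rewrite !ger0_norm ?pi_ge0//; have := pi_ge2 R; lra.
    by rewrite -intr_norm ler1z -gtz0_ge1 normr_gt0.
  by rewrite -[X in _ <= X]real_normK ?num_real// exprn_ege1.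
(* Since [negate_freq i] is injective, Bessel's inequality applies to each component of G. *)
have bound S : uniq S -> \sum_(k <- S) ip u (tc k) ^+ 2 <= C.
  move=> uS; apply: (@le_trans _ _ (\sum_(k <- S) \sum_i ip (fun y =>
    G y i ord0) (tc (negate_freq i k)) ^+ 2)).
    by apply: ler_sum => k _; exact: hat.
  rewrite exchange_big /=; apply: ler_sum => i _.
  rewrite -(big_map (negate_freq i) xpredT (fun k => ip (fun y =>
    G y i ord0) (tc k) ^+ 2)).
  apply: bessel => //; rewrite map_inj_uniq//;
    exact: (can_inj (@negate_freqK d i)).
have [p [Vp pcvg]] := trigspan_dense uL.
(* Completing the square in each coefficient, no trigonometric sum is closer to u than this; density
   then makes the left side nonpositive. *)
have h n : ip u u - C <= ip (p n - u) (p n - u).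
  have [S [a [uS ->]]] := Vp n.
  have -> : ip (trigsum S a - u) (trigsum S a - u) = ip (u - trigsum S a) (u -
    trigsum S a).
    by apply: eq_Rintegral => x _; rewrite -[trigsum S a - u]opprB /= mulrNN.
  rewrite ip_sub_trigsum// lerD2l lerN2; apply: le_trans (bound S uS).
  by apply: ler_sum => k _; have := sqr_ge0 (a k - ip u (tc k));
    rewrite !expr2; lra.
rewrite -subr_le0; rewrite -(cvg_lim (@Rhausdorff R) pcvg); apply: limr_ge;
  first by apply/cvg_ex; exists 0.
exact: nearW.
Qed.
End fourier_L2.

(** * Weak gradients *)

Section weak_gradient.
Context (R : realType) (d : nat).
Local Notation pt := 'rV[R]_d.
Local Notation mu := (@torus_measure R d).
Local Notation L2 := (Lfun mu 2%:E).
Local Notation ip := (@ip _ _ R mu).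
Implicit Types (u v phi : pt -> R) (G H : pt -> 'cV[R]_d).

Lemma Lfun2_continuous_periodic phi : continuous phi -> one_periodic phi -> phi
  \in L2.
Proof.
move=> cphi pphi; have [M pM] := continuous_periodic_bounded cphi pphi.
exact: Lfun2_bounded (continuous_measurable_row cphi) pM.
Qed.

Lemma smooth_Lfun2 phi : smooth phi -> one_periodic phi -> phi \in L2.
Proof. by move=> sphi; apply: Lfun2_continuous_periodic; have [] :=
  sphi 0%N. Qed.

Lemma partial_Lfun2 phi i : smooth phi -> one_periodic phi -> partial i phi \in
  L2.
Proof.
move=> sphi pphi; apply: Lfun2_continuous_periodic.
  by have [_ /(_ i)[_ []]] := sphi 1%N.
move=> j x; rewrite /partial /derive.
set f := (X in lim (X @ _) = _); set g := (X in _ = lim (X @ _)).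
suff -> : f = g by [].
by apply/funext => h; rewrite /f /g /= addrA !pphi.
Qed.

Definition Lfun2_vec : set (pt -> 'cV[R]_d) :=
  [set G | forall i, (fun y => G y i ord0) \in L2].

Lemma Lfun2_vec_lin a G H : Lfun2_vec G -> Lfun2_vec H -> Lfun2_vec (a *: G +
  H).
Proof.
move=> GL HL i.
rewrite (_ : (fun _ => _) = a *: (fun y => G y i ord0) + (fun y => H y i ord0)).
  by apply: Lfun2_lin; [exact: GL|exact: HL].
by apply/funext => y; rewrite -[(a *: G + H) y]/(a *: G y + H y) !mxE.
Qed.

Lemma is_weak_gradient_lin a u v G H : u \in L2 -> v \in L2 ->
  is_weak_gradient u G -> is_weak_gradient v H ->
  is_weak_gradient (a *: u + v) (a *: G + H).
Proof.
move=> uL vL [pG GL uG] [pH HL vH]; have B := ip_psd_form mu; split.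
- by move=> i x; rewrite /= -[LHS]/(a *: G (x + _) + H (x + _)) pG pH.
- exact: Lfun2_vec_lin.
move=> phi sphi pphi i.
rewrite -[LHS]/(ip (a *: u + v) (partial i phi)) (psdP B)//;
  last exact: partial_Lfun2.
have phiL := smooth_Lfun2 sphi pphi.
have -> : \int[mu]_y ((a *: G + H) y i ord0 * phi y) =
    ip (a *: (fun y => G y i ord0) + (fun y => H y i ord0)) phi.
  by apply: eq_Rintegral => y _; rewrite -[(a *: G + H) y]/(a *: G y + H y)
    !mxE.
rewrite (psdP B)//; try exact: GL; try exact: HL.
have := uG phi sphi pphi i; rewrite -[LHS]/(ip u _) => ->.
have := vH phi sphi pphi i; rewrite -[LHS]/(ip v _) => ->.
by rewrite opprD mulrN.
Qed.

Lemma weak_gradient_unique u G H : is_weak_gradient u G -> is_weak_gradient u H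
  ->
  {ae mu, forall x, G x = H x}.
Proof.
move=> [_ GL uG] [_ HL uH]; have B := ip_psd_form mu.
have : {ae mu, forall x, forall i, G x i ord0 = H x i ord0}.
  apply: ae_forall_count => i.
  have : {ae mu, forall x, ((fun y => G y i ord0) - (fun y =>
    H y i ord0)) x = 0}.
    apply: Lfun2_total => [|k]; first exact: Lfun2B.
    rewrite (psdBl B)//; last 3 first.
    - exact: GL.
    - exact: HL.
    - exact: tcas_Lfun2.
    apply/eqP; rewrite subr_eq0 -eqr_opp; apply/eqP.
    have := uG _ (smooth_tcas R k) (one_periodic_tcas k) i.
    by rewrite (uH _ (smooth_tcas R k) (one_periodic_tcas k) i).
  by apply: filterS => x /eqP; rewrite subr_eq0 => /eqP.
by apply: filterS => x h; apply/colP => i.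
Qed.

Lemma gradP u : W12 u -> is_weak_gradient u (grad u).
Proof. by case=> _ _ [G uG]; exact: (@xgetPex _ (fun=>
  0) [set G | is_weak_gradient u G] (ex_intro _ G uG)). Qed.

Lemma W12_lin a u v : W12 u -> W12 v -> W12 (a *: u + v).
Proof.
move=> uW vW; have [[pu uL _] [pv vL _]] := (uW, vW); split.
- by move=> i x; rewrite -[LHS]/(a * u (x + _) + v (x + _)) pu pv.
- exact: Lfun2_lin.
by exists (a *: grad u + grad v); apply: is_weak_gradient_lin => //;
  exact: gradP.
Qed.

Lemma grad_lin a u v : W12 u -> W12 v ->
  {ae mu, forall x, grad (a *: u + v) x = a *: grad u x + grad v x}.
Proof.
move=> uW vW; have [[_ uL _] [_ vL _]] := (uW, vW).
apply: weak_gradient_unique (gradP (W12_lin a uW vW)) _.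
by apply: is_weak_gradient_lin => //; exact: gradP.
Qed.

Lemma H1dot_lin a u v : H1dot u -> H1dot v -> H1dot (a *: u + v).
Proof.
move=> [uW u0] [vW v0]; split; first exact: W12_lin.
have [[_ uL _] [_ vL _]] := (uW, vW).
rewrite -ip_cst1 (psdP (ip_psd_form mu))//; last exact: Lfun2_cst.
by rewrite !ip_cst1 u0 v0 mulr0 addr0.
Qed.

Lemma H1dot0 : H1dot (0 : pt -> R).
Proof.
split; last by rewrite Rintegral_cst ?mul0r.
split; [by []|exact: Lfun2_0|exists 0; split].
- by [].
- by move=> i; rewrite (_ : (fun _ => _) = 0); [exact: Lfun2_0|apply/funext =>
    y; rewrite mxE].
- move=> phi _ _ i; rewrite [in RHS](_ : (fun _ => _) = cst 0); last first.
    by apply/funext => y; rewrite mxE mul0r.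
  under eq_Rintegral do rewrite mul0r.
  by rewrite Rintegral_cst// mul0r oppr0.
Qed.

Lemma H1dotB u v : H1dot u -> H1dot v -> H1dot (u - v).
Proof. by move=> uH vH; rewrite addrC -scaleN1r; exact: H1dot_lin. Qed.

Definition vip G H : R := \int[mu]_y inner (G y) (H y).

Lemma vipE G H : Lfun2_vec G -> Lfun2_vec H ->
  vip G H = \sum_i ip (fun y => G y i ord0) (fun y => H y i ord0).
Proof.
move=> GL HL; rewrite /vip /inner Rintegral_sum// => i.
exact: (integrable_Lfun2M (GL i) (HL i)).
Qed.

Lemma vip_psd_form : psd_form Lfun2_vec vip.
Proof.
have B := ip_psd_form mu; split.
- by move=> i; rewrite (_ : (fun _ => _) = 0); [exact: Lfun2_0|apply/funext =>
    y; rewrite mxE].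
- exact: Lfun2_vec_lin.
- move=> G H _ _; apply: eq_Rintegral => y _; apply: eq_bigr => i _;
    exact: mulrC.
- move=> a G H F GL HL FL.
  have aGHL := Lfun2_vec_lin a GL HL.
  rewrite !vipE// mulr_sumr -big_split/=; apply: eq_bigr => i _.
  rewrite -(psdP B); try exact: GL; try exact: HL; try exact: FL.
  by apply: eq_Rintegral => y _; rewrite -[(a *: G + H) y]/(a *: G y + H y)
    !mxE.
- move=> G GL; apply: Rintegral_ge0 => y _; apply: sumr_ge0 => i _;
    exact: sqr_ge0.
Qed.

End weak_gradient.

(** * Completeness for the norm of the gradient *)

Section H1dot_complete.
Context (R : realType) (d : nat).
Local Notation pt := 'rV[R]_d.
Local Notation mu := (@torus_measure R d).
Local Notation L2 := (Lfun mu 2%:E).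
Local Notation ip := (@ip _ _ R mu).
Implicit Types (u v phi : pt -> R) (G H : pt -> 'cV[R]_d).

Lemma grad_Lfun2 u : W12 u -> Lfun2_vec (grad u).
Proof. by move=> /gradP[]. Qed.

Lemma Lfun2_vecB G H : Lfun2_vec G -> Lfun2_vec H -> Lfun2_vec (G - H).
Proof. exact: (psdVB (@vip_psd_form R d)). Qed.

Lemma vip_ae G G' H : Lfun2_vec G -> Lfun2_vec G' -> Lfun2_vec H ->
  {ae mu, forall x, G x = G' x} -> vip G H = vip G' H.
Proof.
move=> GL GL' HL GG'; rewrite !vipE//; apply: eq_bigr => i _;
  apply: Rintegral_ae.
- by apply: measurable_funM; apply: measurable_Lfun2; [exact: GL|exact: HL].
- by apply: measurable_funM; apply: measurable_Lfun2; [exact: GL'|exact: HL].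
by apply: filterS GG' => x ->.
Qed.

Lemma vip_ae2 G G' : Lfun2_vec G -> Lfun2_vec G' ->
  {ae mu, forall x, G x = G' x} -> vip G G = vip G' G'.
Proof.
move=> GL GL' GG'; rewrite (vip_ae GL GL' GL GG').
by rewrite (psdC (@vip_psd_form R d) GL' GL) (vip_ae GL GL' GL' GG').
Qed.

Lemma gradB u v : W12 u -> W12 v ->
  {ae mu, forall x, grad (u - v) x = (grad u - grad v) x}.
Proof.
move=> uW vW; have := grad_lin (-1) vW uW; rewrite scaleN1r [- v + u]addrC.
by apply: filterS => x ->; rewrite scaleN1r addrC.
Qed.

Lemma H1dot_poincare u : H1dot u -> ip u u <= vip (grad u) (grad u).
Proof.
move=> [uW u0]; have [_ uL _] := uW.
rewrite vipE; [|exact: grad_Lfun2|exact: grad_Lfun2].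
exact: poincare uL (gradP uW) u0.
Qed.

Lemma ip_comp_le_vip G i : Lfun2_vec G ->
  ip (fun y => G y i ord0) (fun y => G y i ord0) <= vip G G.
Proof.
move=> GL; rewrite vipE// (bigD1 i)//= lerDl sumr_ge0// => j _.
exact: (psd_ge0 (ip_psd_form mu) (GL j)).
Qed.

Lemma H1dot_complete (u : nat -> pt -> R) : (forall n, H1dot (u n)) ->
  (forall e : R, 0 < e -> exists N, forall m n, (N <= m)%N -> (N <= n)%N ->
     vip (grad (u m - u n)) (grad (u m - u n)) <= e) ->
  exists w, H1dot w /\
    vip (grad (u n) - grad w) (grad (u n) - grad w) @[n --> \oo] --> (0 : R).
Proof.
move=> uH uC.
have uW n : W12 (u n) by case: (uH n).
have uL n : u n \in L2 by case: (uW n).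
have gL n : Lfun2_vec (grad (u n)) by exact: grad_Lfun2.
have cu : psd_cauchy ip u.
  move=> e e0; have [N HN] := uC e e0; exists N => m n Nm Nn.
  apply: le_trans (HN m n Nm Nn); apply: H1dot_poincare; exact: H1dotB.
have cg i : psd_cauchy ip (fun n y => grad (u n) y i ord0).
  move=> e e0; have [N HN] := uC e e0; exists N => m n Nm Nn.
  apply: le_trans (HN m n Nm Nn).
  have gLB := grad_Lfun2 (H1dotB (uH m) (uH n)).1.
  rewrite (vip_ae2 gLB (Lfun2_vecB (gL m) (gL n)) (gradB (uW m) (uW n))).
  have := ip_comp_le_vip i (Lfun2_vecB (gL m) (gL n)).
  rewrite (_ : (fun y => (grad (u m) - grad (u n)) y i ord0) =
     (fun y => grad (u m) y i ord0) - (fun y => grad (u n) y i ord0))//.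
  by apply/funext => y; rewrite -[LHS]/((grad (u m) y - grad (u n) y) i ord0)
    !mxE.
(* The limits are functionals of the pointwise values, so w and G below inherit exact
   periodicity. *)
have [F [wL wcvg]] := Lfun2_complete uL cu.
have /choice[FG FGP] := fun i => Lfun2_complete (fun n => gL n i) (cg i).
set w : pt -> R := fun x => F _ in wL wcvg.
pose G : pt -> 'cV[R]_d := fun x => \col_i FG i (fun n => grad (u n) x i ord0).
have GE i : (fun y => G y i ord0) = (fun x => FG i (fun n =>
  grad (u n) x i ord0)).
  by apply/funext => x; rewrite mxE.
have GL : Lfun2_vec G by move=> i; rewrite GE; case: (FGP i).
have wG : is_weak_gradient w G.
  split.
  - move=> j x; apply/colP => i; rewrite !mxE; congr (FG i _).
    by apply/funext => n; have [pg _ _] := gradP (uW n); rewrite pg.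
  - exact: GL.
  move=> phi sphi pphi i.
  have h1 : ip (u n) (partial i phi) @[n --> \oo] --> ip w (partial i phi).
    exact: (ip_cvg uL wL (partial_Lfun2 i sphi pphi) wcvg).
  have h2 : - ip (fun y => grad (u n) y i ord0) phi @[n --> \oo] -->
     - ip (fun y => G y i ord0) phi.
    apply: cvgN; apply: (ip_cvg (fun n => gL n i) (GL i) (smooth_Lfun2 sphi
      pphi)).
    by rewrite GE; case: (FGP i).
  have e : (fun n => ip (u n) (partial i phi)) =
      (fun n => - ip (fun y => grad (u n) y i ord0) phi).
    by apply/funext => n; have [_ _ /(_ phi sphi pphi i)] := gradP (uW n).
  by rewrite -e in h2; exact: (cvg_unique _ h1 h2).
have wW : W12 w.
  split => //; last by exists G.
  by move=> j x; congr (F _); apply/funext => n; case: (uW n) => ->.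
exists w; split.
  split=> //; rewrite -ip_cst1.
  have h := ip_cvg uL wL (Lfun2_cst mu 1) wcvg.
  have e : (fun n => ip (u n) (cst 1)) = cst 0.
    by apply/funext => n; rewrite ip_cst1; case: (uH n).
  by rewrite e in h; exact: (cvg_unique _ h (cvg_cst _)).
(* The chosen [grad w] need only agree with the constructed G almost everywhere. *)
have gwG := weak_gradient_unique (gradP wW) wG.
have -> : (fun n => vip (grad (u n) - grad w) (grad (u n) - grad w)) =
   (fun n => \sum_i ip ((fun y => grad (u n) y i ord0) - (fun y => G y i ord0))
                       ((fun y => grad (u n) y i ord0) - (fun y =>
                         G y i ord0))).
  apply/funext => n; have gwL := grad_Lfun2 wW.
  rewrite (@vip_ae2 _ (grad (u n) - G)); [|exact: Lfun2_vecB|exact: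
    Lfun2_vecB|].
    rewrite vipE; [|exact: Lfun2_vecB|exact: Lfun2_vecB].
    apply: eq_bigr => i _; apply: eq_Rintegral => y _.
    have -> : (grad (u n) - G) y i ord0 = grad (u n) y i ord0 - G y i ord0.
      by rewrite -[LHS]/((grad (u n) y - G y) i ord0) 2!mxE.
    by [].
  by apply: filterS gwG => x gx; rewrite -[LHS]/(grad (u n) x - grad w x) gx.
rewrite -[X in _ --> X](_ : \sum_(i < d) (0:R) = 0); last by rewrite big1.
apply: (@cvg_big R 'I_d +%R 0 xpredT (@add_continuous R)) => i _.
by rewrite GE; case: (FGP i).
Qed.

End H1dot_complete.

(** * The energy form *)

Section inner_product.
Context (R : realType) (d : nat).
Implicit Types (x y z : 'cV[R]_d) (B : 'M[R]_d).

Lemma inner_psd_form : psd_form setT (@inner R d).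
Proof.
split=> //.
- by move=> x y _ _; apply: eq_bigr => i _; exact: mulrC.
- move=> a x y z _ _ _; rewrite /inner mulr_sumr -big_split/=.
  by apply: eq_bigr => i _; rewrite !mxE mulrDl mulrA.
- by move=> x _; apply: sumr_ge0 => i _; exact: sqr_ge0.
Qed.

Lemma inner_mulmx B x y : inner (B *m x) y = inner x (B^T *m y).
Proof.
rewrite /inner; under eq_bigr do rewrite mxE mulr_suml.
rewrite exchange_big /=; apply: eq_bigr => j _.
by rewrite mxE mulr_sumr; apply: eq_bigr => i _; rewrite mxE; ring.
Qed.

(** Cauchy-Schwarz on each row of B. *)
Lemma inner_mulmx_le B x :
  inner (B *m x) (B *m x) <= frobenius B ^+ 2 * inner x x.
Proof.
rewrite /frobenius sqr_sqrtr; last first.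
  by apply: sumr_ge0 => i _; apply: sumr_ge0 => j _; exact: sqr_ge0.
rewrite {1}/inner mulr_suml; apply: ler_sum => i _.
have := psd_CauchySchwarz inner_psd_form (x := (row i B)^T) (y := x) I I.
rewrite -expr2; congr (_ <= _ * _).
  by congr (_ ^+ 2); rewrite [RHS]mxE; apply: eq_bigr => j _; rewrite !mxE.
by apply: eq_bigr => j _; rewrite !mxE expr2.
Qed.

Lemma normr_le_frobenius m n (B : 'M[R]_(m, n)) i j : `|B i j| <= frobenius B.
Proof.
rewrite -sqrtr_sqr /frobenius ler_sqrt; last first.
  by apply: sumr_ge0 => k _; apply: sumr_ge0 => l _; exact: sqr_ge0.
rewrite (bigD1 i)//= (bigD1 j)//= -addrA lerDl addr_ge0//.
  by apply: sumr_ge0 => k _; exact: sqr_ge0.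
by apply: sumr_ge0 => k _; apply: sumr_ge0 => l _; exact: sqr_ge0.
Qed.

End inner_product.

Lemma le_Rintegral_ae d (T : measurableType d) (R : realType)
    (mu : {measure set T -> \bar R}) (f g : T -> R) :
  mu.-integrable setT (EFin \o f) -> mu.-integrable setT (EFin \o g) ->
  {ae mu, forall x, f x <= g x} -> \int[mu]_x f x <= \int[mu]_x g x.
Proof.
move=> fi gi fg; rewrite -subr_ge0 -RintegralB//.
have mf : measurable_fun setT f by exact: integrable_measurable fi.
have mg : measurable_fun setT g by exact: integrable_measurable gi.
have -> : \int[mu]_x (g x - f x) = \int[mu]_x `|g x - f x|.
  rewrite /Rintegral; congr fine; apply: ae_eq_integral => //.
  - by apply/measurable_EFinP; exact: measurable_funB.
  - by apply/measurable_EFinP; apply: measurableT_comp => //;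
      exact: measurable_funB.
  case: fg => N [mN N0 sN]; exists N; split => // x /= h; apply: sN => /= fgx.
  by apply: h => _; rewrite ger0_norm// subr_ge0.
by apply: Rintegral_ge0 => x _; exact: normr_ge0.
Qed.

Section energy.
Context (R : realType) (d : nat).
Local Notation pt := 'rV[R]_d.
Local Notation mu := (@torus_measure R d).
Local Notation L2 := (Lfun mu 2%:E).
Local Notation ip := (@ip _ _ R mu).
Implicit Types (u v : pt -> R) (G H : pt -> 'cV[R]_d).

Lemma Linfnorm_ae m n (B : pt -> 'M[R]_(m, n)) :
  {ae mu, forall y, ((frobenius (B y))%:E <= Linfnorm B)%E}.
Proof.
(* [Lnorm] at infinity is an essential supremum when the measure is nonzero. *)
rewrite /Linfnorm unlock (_ : (0 < mu setT)%E); last first.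
  by rewrite [X in (_ < X)%E](_ : _ = 1%E) ?lte01//; exact: probability_setT.
have := @ess_sup_ge _ _ R mu (abse \o (fun y => (frobenius (B y))%:E)).
by apply: filterS => y /=; rewrite ger0_norm// sqrtr_ge0.
Qed.

Lemma Lfun2M_ae_bounded (f g : pt -> R) (M : R) : measurable_fun setT f ->
  {ae mu, forall y, `|f y| <= M} -> g \in L2 -> (fun y => f y * g y) \in L2.
Proof.
move=> mf fM gL; have mg := measurable_Lfun2 gL.
have [_ gi] := (Lfun2P mu g).1 gL.
apply/Lfun2P; split; first exact: measurable_funM.
apply/integrableP; split.
  by apply/measurable_EFinP; apply: measurable_funX; exact: measurable_funM.
have /integrableP[_] := integrableZl measurableT (M ^+ 2) gi.
apply: le_lt_trans; apply: ae_ge0_le_integral => //.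
- by apply: measurableT_comp => //; apply/measurable_EFinP;
    apply: measurable_funX; exact: measurable_funM.
- apply: measurableT_comp => //; apply/measurable_EFinP;
    apply: measurable_funM => //.
  exact: measurable_funX.
apply: filterS fM => y fM _; rewrite /= lee_fin exprMn !normrM ler_wpM2r//.
by have fM' := le_trans fM (ler_norm M); exact: ler_pM.
Qed.

Variables (alpha beta : R) (alpha_gt0 : 0 < alpha).

Section coefficients.
Variables (A : pt -> 'M[R]_d) (hA : PD alpha beta A).

Definition energy G H : R := \int[mu]_y inner (A y *m G y) (H y).

Lemma mulmx_Lfun2 G : Lfun2_vec G -> Lfun2_vec (fun y => A y *m G y).
Proof.
move=> GL i; have [[_ mA Ainf] _] := hA.
rewrite (_ : (fun y => _) = \sum_j (fun y => A y i j * G y j ord0)); last first.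
  by apply/funext => y; rewrite mxE fct_sumE.
elim/big_ind : _ => [|f g fL gL|j _]; first exact: Lfun2_0.
  by rewrite -[f]scale1r; exact: Lfun2_lin.
have A0 : (0 <= Linfnorm A)%E by exact: Lnorm_ge0.
apply: (@Lfun2M_ae_bounded _ _ (fine (Linfnorm A))); [exact: mA| |exact: GL].
have := Linfnorm_ae A; apply: filterS => y.
rewrite -{1}(@fineK _ (Linfnorm A)) ?ge0_fin_numE// lee_fin.
exact: le_trans (normr_le_frobenius _ _ _).
Qed.

Lemma integrable_inner G H : Lfun2_vec G -> Lfun2_vec H ->
  mu.-integrable setT (EFin \o (fun y => inner (G y) (H y))).
Proof.
move=> GL HL; apply: integrable_Rsum => i.
exact: (integrable_Lfun2M (GL i) (HL i)).
Qed.

Lemma energy_ae G G' H : Lfun2_vec G -> Lfun2_vec G' -> Lfun2_vec H ->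
  {ae mu, forall x, G x = G' x} -> energy G H = energy G' H.
Proof.
move=> GL GL' HL GG'; apply: vip_ae => //; try exact: mulmx_Lfun2.
by apply: filterS GG' => x ->.
Qed.

Lemma measurable_inner G H : Lfun2_vec G -> Lfun2_vec H ->
  measurable_fun setT (fun y => inner (G y) (H y)).
Proof.
by move=> GL HL; apply/measurable_EFinP; exact: measurable_int
  (integrable_inner GL HL).
Qed.

Lemma energyC G H : Lfun2_vec G -> Lfun2_vec H -> energy G H = energy H G.
Proof.
move=> GL HL; have [_ Aae] := hA.
apply: Rintegral_ae; try by apply: measurable_inner => //; exact: mulmx_Lfun2.
apply: filterS Aae => y [AT _]; rewrite inner_mulmx AT.
exact: (psdC (@inner_psd_form R d)).
Qed.

Lemma energy_ge G : Lfun2_vec G -> alpha * vip G G <= energy G G.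
Proof.
move=> GL; have [_ Aae] := hA; rewrite /vip -RintegralZl//;
  last exact: integrable_inner.
apply: le_Rintegral_ae.
- by have := integrableZl measurableT alpha (integrable_inner GL GL).
- by apply: integrable_inner => //; exact: mulmx_Lfun2.
apply: filterS Aae => y [_ /(_ (G y))/andP[h _]].
by rewrite (psdC (@inner_psd_form R d)).
Qed.

Lemma energy_le G : Lfun2_vec G -> energy G G <= beta * vip G G.
Proof.
move=> GL; have [_ Aae] := hA; rewrite /vip -RintegralZl//;
  last exact: integrable_inner.
apply: le_Rintegral_ae.
- by apply: integrable_inner => //; exact: mulmx_Lfun2.
- by have := integrableZl measurableT beta (integrable_inner GL GL).
apply: filterS Aae => y [_ /(_ (G y))/andP[_ h]].
by rewrite (psdC (@inner_psd_form R d)).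
Qed.

Lemma energy_psd_form : psd_form (@Lfun2_vec R d) energy.
Proof.
have B := @vip_psd_form R d; split.
- exact: (psdV0 B).
- exact: (psdVP B).
- exact: energyC.
- move=> a G H F GL HL FL.
  rewrite -[RHS](psdP B a (mulmx_Lfun2 GL) (mulmx_Lfun2 HL) FL).
  by apply: eq_Rintegral => y _; congr inner; rewrite mulmxDr -scalemxAr.
- move=> G GL; apply: le_trans (energy_ge GL).
  by rewrite mulr_ge0 ?(ltW alpha_gt0)// (psd_ge0 B).
Qed.

End coefficients.

End energy.

(** * The cell problem *)

Section cell_problem.
Context (R : realType) (d : nat).
Local Notation pt := 'rV[R]_d.
Local Notation mu := (@torus_measure R d).
Local Notation L2 := (Lfun mu 2%:E).
Local Notation ip := (@ip _ _ R mu).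
Implicit Types (u v : pt -> R) (G H : pt -> 'cV[R]_d).

Definition unit_field (l : 'I_d) : pt -> 'cV[R]_d := fun=> delta_mx l ord0.

Lemma unit_field_Lfun2 l : Lfun2_vec (unit_field l).
Proof. by move=> i; exact: Lfun2_cst. Qed.

Lemma vip_unit_field l : vip (unit_field l) (unit_field l) = 1.
Proof.
rewrite /vip /unit_field Rintegral_cst//.
rewrite [X in fine X](_ : _ = 1%E) ?mulr1; last exact: probability_setT.
rewrite /inner (bigD1 l)//= big1 ?addr0 => [|i /negbTE il];
  rewrite !mxE ?eqxx ?mulr1//.
by rewrite il mul0r.
Qed.

Lemma H1dot_grad_Lfun2 u : H1dot u -> Lfun2_vec (grad u).
Proof. by case=> uW _; exact: grad_Lfun2. Qed.

Definition cell_component (A : pt -> 'M[R]_d) l w :=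
  H1dot w /\ forall v, H1dot v ->
    energy A (grad w) (grad v) = - energy A (unit_field l) (grad v).

Variables (alpha beta : R) (alpha_gt0 : 0 < alpha).

Section one_coefficient.
Variables (A : pt -> 'M[R]_d) (hA : PD alpha beta A).
Let E := energy_psd_form alpha_gt0 hA.

Lemma energy_grad_lin a u v G : H1dot u -> H1dot v -> Lfun2_vec G ->
  energy A (grad (a *: u + v)) G = a * energy A (grad u) G + energy A (grad v)
    G.
Proof.
move=> uH vH GL; have uL := H1dot_grad_Lfun2 uH; have vL := H1dot_grad_Lfun2 vH.
rewrite -(psdP E)//; apply: (energy_ae hA) => //.
- exact: H1dot_grad_Lfun2 (H1dot_lin a uH vH).
- exact: (psdVP E).
by have [uW _] := uH; have [vW _] := vH; exact: grad_lin.
Qed.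

Lemma energy_gradB u v G : H1dot u -> H1dot v -> Lfun2_vec G ->
  energy A (grad (u - v)) G = energy A (grad u) G - energy A (grad v) G.
Proof.
by move=> uH vH GL; rewrite addrC -scaleN1r energy_grad_lin// mulN1r addrC.
Qed.

Lemma H1dot_energy_psd_form :
  psd_form (@H1dot R d) (fun u v => energy A (grad u) (grad v)).
Proof.
split.
- exact: H1dot0.
- by move=> a u v; exact: H1dot_lin.
- by move=> u v /H1dot_grad_Lfun2 uL /H1dot_grad_Lfun2 vL; exact: (psdC E).
- by move=> a u v w uH vH /H1dot_grad_Lfun2; exact: energy_grad_lin.
- by move=> u /H1dot_grad_Lfun2 uL; exact: (psd_ge0 E).
Qed.

Lemma energy_unit_field_le l : energy A (unit_field l) (unit_field l) <= beta.
Proof.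
by have := energy_le hA (unit_field_Lfun2 l); rewrite vip_unit_field mulr1.
Qed.

Lemma cell_component_exists l : exists w, cell_component A l w.
Proof.
have eL := unit_field_Lfun2 l.
pose f v := - energy A (unit_field l) (grad v).
have fP a u v : H1dot u -> H1dot v -> f (a *: u + v) = a * f u + f v.
  move=> uH vH; rewrite /f.
  have sym w : H1dot w -> energy A (unit_field l) (grad w) = energy A (grad w)
    (unit_field l).
    by move=> /H1dot_grad_Lfun2 wL; exact: (psdC E).
  rewrite !sym//; last exact: H1dot_lin.
  by rewrite energy_grad_lin// opprD mulrN.
(* The constant C of [psd_riesz] is the energy of the unit field. *)
have fC v : H1dot v -> f v ^+ 2 <=
    energy A (unit_field l) (unit_field l) * energy A (grad v) (grad v).
  move=> /H1dot_grad_Lfun2 vL; rewrite /f sqrrN.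
  exact: (psd_CauchySchwarz E).
have [u [uH uC ucvg]] := psd_riesz H1dot_energy_psd_form (psd_ge0 E eL) fP fC.
have uVC (e : R) : 0 < e -> exists N, forall m n, (N <= m)%N -> (N <= n)%N ->
     vip (grad (u m - u n)) (grad (u m - u n)) <= e.
  move=> e0; have [N HN] := uC _ (mulr_gt0 alpha_gt0 e0); exists N => m n Nm Nn.
  rewrite -(ler_pM2l alpha_gt0); apply: le_trans (HN m n Nm Nn).
  by apply: (energy_ge hA); apply: H1dot_grad_Lfun2; exact: H1dotB.
have [w [wH wcvg]] := H1dot_complete uH uVC.
have wL := H1dot_grad_Lfun2 wH.
exists w; split=> // v vH; have vL := H1dot_grad_Lfun2 vH.
(* The limit is taken in the gradient norm; Cauchy-Schwarz for the energy and its upper bound by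
   beta transfer it to the equation. *)
have h : energy A (grad (u n)) (grad v) @[n --> \oo] --> energy A (grad w)
  (grad v).
  have C0 := psd_ge0 E vL; set C := energy A (grad v) (grad v) in C0.
  apply/cvgrPdist_le => /= e e0.
  (* The sign of beta is read off from the nonnegative energy of the unit field. *)
  have b0 : 0 <= beta.
    by apply: le_trans (energy_unit_field_le l); exact: (psd_ge0 E eL).
  have e2 : 0 < e ^+ 2 / (beta * C + 1).
    by rewrite divr_gt0 ?exprn_gt0// ltr_wpDl// mulr_ge0.
  move/cvgrPdist_le : wcvg => /(_ _ e2); apply: filterS => n.
  have unL := H1dot_grad_Lfun2 (uH n).
  have uwL := Lfun2_vecB unL wL.
  have V0 := psd_ge0 (@vip_psd_form R d) uwL.
  rewrite sub0r normrN ger0_norm// => h.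
  rewrite distrC -(psdBl E unL wL vL).
  rewrite -ler_sqr ?nnegrE ?(ltW e0)// real_normK ?num_real//.
  apply: (le_trans (psd_CauchySchwarz E uwL vL)).
  have hl := energy_le hA uwL.
  apply: (le_trans (ler_wpM2r C0 hl)).
  move: h; rewrite ler_pdivlMr; last by rewrite ltr_wpDl// mulr_ge0.
  have K (a b c r : R) : 0 <= a -> a * (b * c + 1) <= r -> b * a * c <= r by
    nra.
  exact: K.
exact: (cvg_unique _ h (ucvg v vH)).
Qed.

(** Tested against itself, the difference of two solutions has zero energy; coercivity and the
    Poincare inequality then make it vanish almost everywhere. *)
Lemma cell_component_unique l w w' : cell_component A l w -> cell_component A l
  w' ->
  {ae mu, forall x, w' x = w x}.
Proof.
move=> [wH wE] [wH' wE']; have dH := H1dotB wH' wH.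
have dL := H1dot_grad_Lfun2 dH.
have d0 : energy A (grad (w' - w)) (grad (w' - w)) = 0.
  by rewrite energy_gradB// wE// wE'// subrr.
have := energy_ge hA dL; rewrite d0 pmulr_rle0// => v0.
have [[_ dL2 _] _] := dH.
have : ip (w' - w) (w' - w) = 0.
  apply/eqP; rewrite eq_le (le_trans (H1dot_poincare dH) v0)/=.
  exact: (psd_ge0 (ip_psd_form mu) dL2).
move=> /(ip_eq0 dL2); apply: filterS => x /eqP; rewrite subr_eq0 => /eqP //.
Qed.

(* Expanding the square with the equation tested against w itself; positivity
   of the left-hand side then gives the energy bound. *)
Lemma cell_component_energy l w : cell_component A l w ->
  energy A (unit_field l + grad w) (unit_field l + grad w) =
  energy A (unit_field l) (unit_field l) - energy A (grad w) (grad w).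
Proof.
move=> [wH wE]; have wL := H1dot_grad_Lfun2 wH; have eL := unit_field_Lfun2 l.
rewrite -{1 2}[unit_field l]scale1r (psd_sqr E)//.
have := wE _ wH; lra.
Qed.

Lemma cell_component_bound l w : cell_component A l w ->
  vip (grad w) (grad w) <= beta / alpha.
Proof.
move=> wl; have [wH _] := wl; have wL := H1dot_grad_Lfun2 wH.
have eL := unit_field_Lfun2 l.
have := psd_ge0 E (psdVD E eL wL); rewrite cell_component_energy//.
have := energy_ge hA wL; have := energy_unit_field_le l.
by rewrite ler_pdivlMr//; lra.
Qed.

Lemma cell_component_bound1 l w : cell_component A l w ->
  vip (unit_field l + grad w) (unit_field l + grad w) <= beta / alpha.
Proof.
move=> wl; have [wH _] := wl; have wL := H1dot_grad_Lfun2 wH.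
have eL := unit_field_Lfun2 l.
have := energy_ge hA (psdVD E eL wL); rewrite cell_component_energy//.
have := psd_ge0 E wL; have := energy_unit_field_le l.
by rewrite ler_pdivlMr//; lra.
Qed.

End one_coefficient.

(** With D = (A1 - A2)(e + grad w1) and H the gradient of the difference, alpha |H|^2 <= (D, H) <=
    |D| |H|, and |D|^2 <= L^2 |e + grad w1|^2 <= L^2 beta / alpha. *)
Lemma cell_component_stability (A1 A2 : pt -> 'M[R]_d) (L : R) l w1 w2 :
  PD alpha beta A1 -> PD alpha beta A2 -> 0 <= L ->
  {ae mu, forall y, frobenius (A1 y - A2 y) <= L} ->
  cell_component A1 l w1 -> cell_component A2 l w2 ->
  vip (grad (w2 - w1)) (grad (w2 - w1)) <= L ^+ 2 * (beta / alpha) / alpha ^+ 2.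
Proof.
move=> hA1 hA2 L0 hL wl1 wl2; have [wH1 wE1] := wl1; have [wH2 wE2] := wl2.
have E1 := energy_psd_form alpha_gt0 hA1; have E2 :=
  energy_psd_form alpha_gt0 hA2.
have dH := H1dotB wH2 wH1; have dL := H1dot_grad_Lfun2 dH.
have wL1 := H1dot_grad_Lfun2 wH1; have wL2 := H1dot_grad_Lfun2 wH2.
have eL := unit_field_Lfun2 l.
set H := grad (w2 - w1) in dL *; pose G := unit_field l + grad w1.
have GL : Lfun2_vec G := psdVD E1 eL wL1.
(* The first term on the right is 0 by the equation of w1; it is kept so that the coefficients
   appear as a difference. *)
have eqn : energy A2 H H = energy A1 G H - energy A2 G H.
  rewrite {1}/H (energy_gradB hA2)//.
  rewrite /G !(psdDl E1)// !(psdDl E2)// wE1// wE2//; ring.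
pose D := (fun y => A1 y *m G y) - (fun y => A2 y *m G y).
have D1 := mulmx_Lfun2 hA1 GL; have D2 := mulmx_Lfun2 hA2 GL.
have DL : Lfun2_vec D := Lfun2_vecB D1 D2.
have V := @vip_psd_form R d.
have eqD : energy A1 G H - energy A2 G H = vip D H by rewrite (psdBl V D1 D2
  dL).
have leD : vip D D <= L ^+ 2 * vip G G.
  rewrite /vip -RintegralZl//; last exact: integrable_inner.
  apply: le_Rintegral_ae.
  - exact: integrable_inner.
  - by have := integrableZl measurableT (L ^+ 2) (integrable_inner GL GL).
  apply: filterS hL => y hy.
  rewrite (_ : D y = (A1 y - A2 y) *m G y); last by rewrite mulmxBl.
  apply: (le_trans (inner_mulmx_le _ _)); apply: ler_wpM2r.
    exact: (psd_ge0 (@inner_psd_form R d)).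
  by rewrite lerXn2r ?nnegrE// sqrtr_ge0.
have GB : vip G G <= beta / alpha := cell_component_bound1 hA1 wl1.
have G0 := psd_ge0 V GL.
have CS := psd_CauchySchwarz V DL dL.
have := energy_ge hA2 dL; rewrite eqn eqD => coer.
have H0 := psd_ge0 V dL; have L2 : 0 <= L ^+ 2 by exact: sqr_ge0.
move: coer CS leD GB H0 G0.
move: (vip D D) (vip D H) (vip H H) (vip G G) => p q r s aq qpr pLs sb r0 s0.
rewrite ler_pdivlMr ?exprn_gt0//.
(* The estimate is quadratic in r = |H|^2, and one factor r has to be divided out. *)
have [->|rn0] := eqVneq r 0.
  rewrite mul0r; apply: mulr_ge0 => //; exact: le_trans sb.
have rp : 0 < r by rewrite lt_neqAle eq_sym rn0.
rewrite -(ler_pM2l rp).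
have h1 : (alpha * r) ^+ 2 <= q ^+ 2.
  by rewrite lerXn2r// ?nnegrE ?mulr_ge0 ?(ltW alpha_gt0)// (le_trans _ aq)//
    mulr_ge0// ltW.
apply: (@le_trans _ _ (q ^+ 2)); first by apply: le_trans h1; rewrite exprMn;
  lra.
apply: (le_trans qpr); rewrite mulrC ler_wpM2l//.
by apply: (le_trans pLs); rewrite ler_wpM2l.
Qed.

(** The rows of the Jacobian are the gradients of the components, so its squared Frobenius norm is
    the sum of their squared lengths. *)
Lemma H1dot_norm_le n (chi : pt -> 'cV[R]_n) (c : R) : 0 <= c ->
  (forall l, W12 (component chi l)) ->
  \sum_l vip (grad (component chi l)) (grad (component chi l)) <= c ^+ 2 ->
  (H1dot_norm chi <= c%:E)%E.
Proof.
move=> c0 cW; pose g l := grad (component chi l).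
have gL l : Lfun2_vec (g l) by exact: grad_Lfun2.
have gi l := integrable_inner (gL l) (gL l).
rewrite -Rintegral_sum// => le_c.
rewrite /H1dot_norm /L2norm unlock.
rewrite (_ : (\int[mu]_x _)%E = (\int[mu]_y \sum_l inner (g l y) (g l y))%:E).
  rewrite poweR_EFin powR12_sqrt ?lee_fin; last first.
    by apply: Rintegral_ge0 => y _; apply: sumr_ge0 => l _;
      exact: (psd_ge0 (@inner_psd_form R d)).
  by rewrite -[leRHS]ger0_norm// -sqrtr_sqr ler_wsqrtr.
rewrite /Rintegral fineK; last exact: integrable_fin_num (integrable_Rsum _ gi).
apply: eq_integral => y _ /=.
rewrite powR_mulrn// real_normK ?num_real// /frobenius sqr_sqrtr; last first.
  by apply: sumr_ge0 => i _; apply: sumr_ge0 => j _; exact: sqr_ge0.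
by congr EFin; apply: eq_bigr => l _; apply: eq_bigr => j _; rewrite mxE expr2.
Qed.

Lemma cell_solutionP A chi : cell_solution A chi <->
  forall l, cell_component A l (component chi l).
Proof.
by split=> [[cH cE] l|h]; [split => //; exact: cE|split=> l;
  [by case: (h l)|case: (h l)]].
Qed.

End cell_problem.

Theorem proposition1p1 (R : realType) (d : nat) (d_gt0 : (0 < d)%N)
    (alpha beta : R) (alpha_gt0 : 0 < alpha) (le_alpha_beta : alpha <= beta) :
  (forall A : 'rV[R]_d -> 'M[R]_d, PD alpha beta A ->
     exists chi : 'rV[R]_d -> 'cV[R]_d,
       [/\ cell_solution A chi,
           forall chi' : 'rV[R]_d -> 'cV[R]_d, cell_solution A chi' ->
             chi' = chi %[ae torus_measure d] &
           (H1dot_norm chi <= (Num.sqrt d%:R * beta / alpha)%:E)%E]) /\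
  (forall (A1 A2 : 'rV[R]_d -> 'M[R]_d) (chi1 chi2 : 'rV[R]_d -> 'cV[R]_d),
     PD alpha beta A1 -> PD alpha beta A2 ->
     cell_solution A1 chi1 -> cell_solution A2 chi2 ->
     (H1dot_norm (fun y => (chi2 y - chi1 y)%R) <=
      (Num.sqrt d%:R / alpha * (1 + beta / alpha))%:E *
      Linfnorm (fun y => (A1 y - A2 y)%R))%E).
Proof.
have beta_gt0 : 0 < beta := lt_le_trans alpha_gt0 le_alpha_beta.
have t1 : 1 <= beta / alpha by rewrite ler_pdivlMr// mul1r.
have sqrtd : Num.sqrt d%:R ^+ 2 = d%:R :> R by rewrite sqr_sqrtr.
split.
  move=> A hA.
  have /choice[w wP] := cell_component_exists alpha_gt0 hA.
  pose chi : 'rV[R]_d -> 'cV[R]_d := fun y => \col_l w l y.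
  have chiE l : component chi l = w l by apply/funext => y;
    rewrite /component mxE.
  have chiP : forall l, cell_component A l (component chi l) by move=> l;
    rewrite chiE.
  exists chi; split.
  - exact/cell_solutionP.
  - move=> chi' /cell_solutionP chiP'.
    have : {ae torus_measure d, forall y, forall l,
      component chi' l y = component chi l y}.
      apply: ae_forall_count => l.
      exact: (cell_component_unique alpha_gt0 hA (chiP l) (chiP' l)).
    by apply: filterS => y h _; apply/colP => l; exact: h.
  - apply: H1dot_norm_le => [|l|].
    + by rewrite !mulr_ge0 ?sqrtr_ge0 ?invr_ge0// ltW.
    + by case: (chiP l) => -[].
    (* Then d t <= d t^2 for t = beta / alpha >= 1. *)
    apply: (@le_trans _ _ (\sum_(l < d) (beta / alpha))).
      by apply: ler_sum => l _; have := (cell_component_bound alpha_gt0 hA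
        (chiP l)).
    rewrite sumr_const card_ord -mulrA exprMn sqrtd -[leLHS]mulr_natl
      ler_wpM2l//.
    by rewrite expr2 ler_peMl// (le_trans ler01).
move=> A1 A2 chi1 chi2 hA1 hA2 /cell_solutionP c1 /cell_solutionP c2.
have c0 : 0 < Num.sqrt d%:R / alpha * (1 + beta / alpha).
  by rewrite mulr_gt0 ?divr_gt0 ?sqrtr_gt0 ?ltr0n// ltr_wpDr// (le_trans ler01).
set B : 'rV[R]_d -> 'M[R]_d := fun y => A1 y - A2 y.
have := @Linfnorm_ae R d _ _ B; have : (0 <= Linfnorm B)%E by exact: Lnorm_ge0.
(* An infinite norm makes the right-hand side infinite, its other factor being positive as d > 0;
   nonnegativity excludes minus infinity. *)
case: (Linfnorm B) => [L L0 hL|_ _|//]; last by rewrite gt0_muley ?leey//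
  lte_fin.
have compB l : component (fun y => chi2 y - chi1 y) l = component chi2 l -
  component chi1 l.
  by apply/funext => y; rewrite /component !mxE.
rewrite -EFinM; apply: H1dot_norm_le => [|l|].
- by rewrite mulr_ge0// ltW.
- by rewrite compB; case: (H1dotB (c2 l).1 (c1 l).1).
apply: (@le_trans _ _ (\sum_(l < d) (L ^+ 2 * (beta / alpha) / alpha ^+ 2))).
  apply: ler_sum => l _; rewrite compB.
  exact: (cell_component_stability alpha_gt0 hA1 hA2 L0 hL (c1 l) (c2 l)).
rewrite sumr_const card_ord -[leLHS]mulr_natl !exprMn sqrtd exprVn.
move: t1; move: (beta / alpha) => t t1.
have : 0 <= d%:R * (L ^+ 2 * (alpha ^+ 2)^-1) :> R.
  by rewrite !mulr_ge0 ?invr_ge0 ?sqr_ge0.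
(* This replaces the factor t of the component estimates by the square of 1 + beta / alpha. *)
have : t <= (1 + t) ^+ 2 by rewrite sqrrD; have := sqr_ge0 t; lra.
move: (_^-1) ((1 + t) ^+ 2) (L ^+ 2) (d%:R : R) => a b c e tb h.
have := ler_wpM2l h tb; lra.
Qed.
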